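(* Assume the L-smoothness assumption (with $L>0$) and the bounded variance assumption, and let $f^\star:=\inf_xf(x)>-\infty$. Let $c>0$ and suppose $\gamma_b<\min\{\frac1{2cL},\frac1{25L\tau}\}$. Then there is an absolute constant $C>0$ such that for all $T\ge1$ the iterates of FedSPS (and equally of FedAvg with constant stepsize $\gamma_b$, i.e. the same scheme with $\gamma_t^i\equiv\gamma_b$) satisfy $$\min_{0\le t\le T-1}\mathbb E\|\nabla f(\bar x_t)\|^2\le C\Big(\frac{f(\bar x_0)-f^\star}{\gamma_bT}+\gamma_b\frac{L\sigma^2}n+\gamma_b^2L^2\tau(\sigma^2+\tau\zeta^2)\Big).$$
   Context: Setting: integers $n\ge1$, $d\ge1$, $\tau\ge1$. For each $i\in[n]$, $\mathcal D_i$ is a probability distribution on $\Omega_i$, $F_i:\mathbb R^d\times\Omega_i\to\mathbb R$ with $F_i(\cdot,\xi)$ differentiable for $\xi\in\operatorname{supp}(\mathcal D_i)$; $f_i(x):=\mathbb E_{\xi\sim\mathcal D_i}F_i(x,\xi)$, $\mathbb E\nabla F_i(x,\xi)=\nabla f_i(x)$, $f:=\frac1n\sum_if_i$. $F_i^\star:=\inf_{\xi\in\operatorname{supp}(\mathcal D_i),x}F_i(x,\xi)$ (finite) and $\ell_i^\star\le F_i^\star$ are given reals. FedSPS with parameters $c,\gamma_b>0$: $x_0^i=x_0$; at each $t$, client $i$ draws $\xi_t^i\sim\mathcal D_i$ independently of everything else, sets $g_t^i:=\nabla F_i(x_t^i,\xi_t^i)$, $\gamma_t^i:=\min\{\frac{F_i(x_t^i,\xi_t^i)-\ell_i^\star}{c\|g_t^i\|^2},\gamma_b\}$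 (first term $+\infty$ if $g_t^i=0$); if $t+1$ is a multiple of $\tau$, $x_{t+1}^i:=\frac1n\sum_j(x_t^j-\gamma_t^jg_t^j)$ for all $i$, else $x_{t+1}^i:=x_t^i-\gamma_t^ig_t^i$. $\bar x_t:=\frac1n\sum_ix_t^i$. L-smoothness assumption: $\|\nabla F_i(y,\xi)-\nabla F_i(x,\xi)\|\le L\|x-y\|$ for all $i$, $\xi\in\operatorname{supp}(\mathcal D_i)$, $x,y$. Bounded variance assumption: there are $\sigma,\zeta\ge0$ with $\mathbb E_{\xi\sim\mathcal D_i}\|\nabla F_i(x,\xi)-\nabla f_i(x)\|^2\le\sigma^2$ for all $i$ and $x$, and $\frac1n\sum_{i=1}^n\|\nabla f_i(x)-\nabla f(x)\|^2\le\zeta^2$ for all $x$. *)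

(* Defs.v *)
From HB Require Import structures.
From mathcomp Require Import all_boot all_order all_algebra.
From mathcomp Require Import all_classical all_reals all_analysis.
Import Order.TTheory GRing.Theory Num.Theory.
Import numFieldNormedType.Exports.

Set Implicit Arguments.
Unset Strict Implicit.
Unset Printing Implicit Defensive.

Local Open Scope ring_scope.
Local Open Scope classical_set_scope.

Section Euclid.
Context {R : realType} {d : nat}.

(* Euclidean inner product, squared norm and norm on R^d = 'rV[R]_d.
   (The library norm on matrices is the max-norm, so we do not use it.) *)
Definition dotv (u v : 'rV[R]_d) : R := \sum_(j < d) u 0 j * v 0 j.
Definition sqnorm (u : 'rV[R]_d) : R := dotv u u.
Definition enorm (u : 'rV[R]_d) : R := Num.sqrt (sqnorm u).

Definition gradient (f : 'rV[R]_d -> R) (x : 'rV[R]_d) : 'rV[R]_d :=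
  \row_(j < d) ('d f x (delta_mx 0 j : 'rV[R]_d)).

End Euclid.

Section Algo.
Context {R : realType} {d n : nat} {Om : 'I_n -> Type}.

Definition fed_step (tau : nat)
  (gam : forall i, 'rV[R]_d -> Om i -> R)
  (grd : forall i, 'rV[R]_d -> Om i -> 'rV[R]_d)
  (t : nat) (xs : 'I_n -> 'rV[R]_d) (s : forall i, Om i) : 'I_n -> 'rV[R]_d :=
  let y := fun i => xs i - gam i (xs i) (s i) *: grd i (xs i) (s i) in
  if (tau %| t.+1)%N then (fun _ => n%:R^-1 *: \sum_(j < n) y j) else y.

Fixpoint fed_iter (tau : nat)
  (gam : forall i, 'rV[R]_d -> Om i -> R)
  (grd : forall i, 'rV[R]_d -> Om i -> 'rV[R]_d)
  (x0 : 'rV[R]_d) (s : nat -> forall i, Om i) (t : nat) : 'I_n -> 'rV[R]_d :=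
  match t with
  | 0 => fun _ => x0
  | t'.+1 => fed_step tau gam grd t' (fed_iter tau gam grd x0 s t') (s t')
  end.

Definition avg_iter (xs : 'I_n -> 'rV[R]_d) : 'rV[R]_d :=
  n%:R^-1 *: \sum_(i < n) xs i.

End Algo.

(* Stochastic Polyak step size:
   min { (Fv - l) / (c ||g||^2), gb }, the first term being +oo when g = 0. *)
Definition sps_step {R : realType} {d : nat} (c gb l Fv : R) (g : 'rV[R]_d) : R :=
  if sqnorm g == 0 then gb else Num.min ((Fv - l) / (c * sqnorm g)) gb.

Definition mutually_independent {R : realType} {dP : measure_display}
  {Om : measurableType dP} (P : probability Om R) {I : eqType}
  {dT : I -> measure_display} (T : forall k, measurableType (dT k))
  (X : forall k, Om -> T k) : Prop :=
  forall (J : seq I) (A : forall k, set (T k)),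
    uniq J -> (forall k, measurable (A k)) ->
    P (\bigcap_(k in [set` J]) (X k @^-1` A k)) =
    (\prod_(k <- J) P (X k @^-1` A k))%E.

(* Main.v *)
(* Write g for the step bound. For xi in the support, F_i(., xi) is L-smooth and
   bounded below by ell_i, so |grad F_i|^2 <= 2 L (F_i - ell_i); as g < 1/(2cL), the
   Polyak quotient exceeds g and the minimum is always g. Almost surely FedSPS is
   therefore FedAvg with step g.

   For FedAvg let xb_t be the average of the clients, V_t their mean squared distance
   to xb_t, b_t the average of grad f_i(x_t^i), and e_t the averaged gradient noise.
   The descent lemma for f along xb_{t+1} = xb_t - g (b_t + e_t), together with
   |grad f(xb_t) - b_t|^2 <= L^2 V_t, gives
     E f(xb_{t+1}) <= E f(xb_t) - g/2 E|grad f(xb_t)|^2 + g L^2/2 E V_t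
                      + g^2 L sigma^2/(2n).
   V_t vanishes at communication rounds, and otherwise Young's inequality with weight
   1/tau and the vanishing of the noise cross terms give
     E V_{t+1} <= (1 + 2/tau) E V_t + g^2 (sigma^2 + 4 tau zeta^2),
   whence E V_t <= e^2 tau g^2 (sigma^2 + 4 tau zeta^2). Summing over t concludes.

   The cross terms vanish because the sample xi_t^i is independent of the sigma-algebra
   generated by all other samples, with respect to which x_t^j and the noise of the
   other clients are measurable. *)
Require Import Defs.
From HB Require Import structures.
From mathcomp Require Import all_boot all_order all_algebra.
From mathcomp Require Import all_classical all_reals all_analysis.
From mathcomp Require Import measurable_realfun.
From mathcomp Require Import ring lra.
Import Order.TTheory GRing.Theory Num.Theory.
Import numFieldNormedType.Exports.
Set Implicit Arguments.
Unset Strict Implicit.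
Unset Printing Implicit Defensive.
Local Open Scope ring_scope.
Local Open Scope classical_set_scope.

(** * Euclidean inner product and norm *)

Section Vectors.
Context {R : realType} {d : nat}.
Implicit Types (u v w : 'rV[R]_d) (a : R).

Lemma dotvC u v : dotv u v = dotv v u.
Proof. by apply: eq_bigr => j _; rewrite mulrC. Qed.

Lemma dotvDl u v w : dotv (u + v) w = dotv u w + dotv v w.
Proof. by rewrite -big_split; apply: eq_bigr => j _; rewrite mxE mulrDl. Qed.

Lemma dotvZl a u v : dotv (a *: u) v = a * dotv u v.
Proof. by rewrite /dotv mulr_sumr; apply: eq_bigr => j _; rewrite mxE mulrA. Qed.

Lemma dotvNl u v : dotv (- u) v = - dotv u v.
Proof. by rewrite -scaleN1r dotvZl mulN1r. Qed.

Lemma dotvBl u v w : dotv (u - v) w = dotv u w - dotv v w.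
Proof. by rewrite dotvDl dotvNl. Qed.

Lemma dotvDr u v w : dotv w (u + v) = dotv w u + dotv w v.
Proof. by rewrite dotvC dotvDl !(dotvC w). Qed.

Lemma dotvZr a u v : dotv u (a *: v) = a * dotv u v.
Proof. by rewrite dotvC dotvZl dotvC. Qed.

Lemma dotvNr u v : dotv u (- v) = - dotv u v.
Proof. by rewrite dotvC dotvNl dotvC. Qed.

Lemma dotvBr u v w : dotv w (u - v) = dotv w u - dotv w v.
Proof. by rewrite dotvDr dotvNr. Qed.

Lemma dotv0l u : dotv 0 u = 0.
Proof. by rewrite -(scale0r 0) dotvZl mul0r. Qed.

Lemma dotv_suml (I : Type) (r : seq I) (F : I -> 'rV[R]_d) v :
  dotv (\sum_(i <- r) F i) v = \sum_(i <- r) dotv (F i) v.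
Proof.
elim: r => [|i r IH]; first by rewrite !big_nil dotv0l.
by rewrite !big_cons dotvDl IH.
Qed.

Lemma dotv_sumr (I : Type) (r : seq I) (F : I -> 'rV[R]_d) v :
  dotv v (\sum_(i <- r) F i) = \sum_(i <- r) dotv v (F i).
Proof. by rewrite dotvC dotv_suml; apply: eq_bigr => i _; rewrite dotvC. Qed.

Lemma sqnorm_ge0 u : 0 <= sqnorm u.
Proof. by apply: sumr_ge0 => j _; rewrite -expr2 sqr_ge0. Qed.

Lemma sqnorm0 : sqnorm (0 : 'rV[R]_d) = 0.
Proof. exact: dotv0l. Qed.

Lemma sqnormZ a u : sqnorm (a *: u) = a ^+ 2 * sqnorm u.
Proof. by rewrite /sqnorm dotvZl dotvZr mulrA. Qed.

Lemma sqnormN u : sqnorm (- u) = sqnorm u.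
Proof. by rewrite /sqnorm dotvNl dotvNr opprK. Qed.

Lemma sqnormBC u v : sqnorm (u - v) = sqnorm (v - u).
Proof. by rewrite -sqnormN opprB. Qed.

Lemma sqnormD u v : sqnorm (u + v) = sqnorm u + 2 * dotv u v + sqnorm v.
Proof. by rewrite /sqnorm dotvDl !dotvDr (dotvC v u); ring. Qed.

Lemma sqnormB u v : sqnorm (u - v) = sqnorm u - 2 * dotv u v + sqnorm v.
Proof. by rewrite sqnormD dotvNr sqnormN mulrN. Qed.

Lemma coord_sqr_le u j : (u 0 j) ^+ 2 <= sqnorm u.
Proof.
rewrite /sqnorm /dotv (bigD1 j)//= -expr2 lerDl.
by apply: sumr_ge0 => k _; rewrite -expr2 sqr_ge0.
Qed.

(** Expanding [0 <= sqnorm (u - a *: v)] and dividing by [a] bounds the cross term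
    [2 * dotv u v]. *)
Lemma sqnormD_young a u v : 0 < a ->
  sqnorm (u + v) <= (1 + a^-1) * sqnorm u + (1 + a) * sqnorm v.
Proof.
move=> a0; have := sqnorm_ge0 (u - a *: v).
rewrite sqnormB sqnormD sqnormZ dotvZr => H.
have : 0 <= a^-1 * (sqnorm u - 2 * (a * dotv u v) + a ^+ 2 * sqnorm v).
  by rewrite mulr_ge0// invr_ge0 ltW.
have -> : a^-1 * (sqnorm u - 2 * (a * dotv u v) + a ^+ 2 * sqnorm v) =
  a^-1 * sqnorm u - 2 * dotv u v + a * sqnorm v by field; rewrite gt_eqF.
by rewrite !mulrDl !mul1r; lra.
Qed.

Lemma sqnormD_le u v : sqnorm (u + v) <= 2 * sqnorm u + 2 * sqnorm v.
Proof. by have := sqnormD_young u v ltr01; rewrite invr1. Qed.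

Lemma sqr_enorm u : enorm u ^+ 2 = sqnorm u.
Proof. by rewrite sqr_sqrtr// sqnorm_ge0. Qed.

Lemma enorm_ge0 u : 0 <= enorm u.
Proof. exact: sqrtr_ge0. Qed.

(** Cauchy-Schwarz: the vector [sqnorm v *: u - dotv u v *: v] has nonnegative square, which factors
    as [sqnorm v] times the wanted difference. A vector [v] of norm zero is treated apart. *)
Lemma dotv_sqr_le u v : dotv u v ^+ 2 <= sqnorm u * sqnorm v.
Proof.
have [v0|v0] := eqVneq (sqnorm v) 0.
  suff -> : v = 0 by rewrite dotvC dotv0l sqnorm0 mulr0 expr0n.
  apply/rowP => j; rewrite mxE; apply/eqP; rewrite -sqrf_eq0 eq_le sqr_ge0.
  by rewrite andbT -v0 coord_sqr_le.
have vp : 0 < sqnorm v by rewrite lt_neqAle eq_sym v0 sqnorm_ge0.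
have := sqnorm_ge0 (sqnorm v *: u - dotv u v *: v).
rewrite sqnormB !sqnormZ dotvZl dotvZr => H.
have {H} : 0 <= sqnorm v * (sqnorm u * sqnorm v - dotv u v ^+ 2).
  by apply: le_trans H _; rewrite le_eqVlt; apply/orP; left; apply/eqP; ring.
by rewrite pmulr_rge0// subr_ge0.
Qed.

Lemma dotv_le_enorm u v : dotv u v <= enorm u * enorm v.
Proof.
rewrite /enorm -sqrtrM ?sqnorm_ge0//.
apply: le_trans (ler_norm _) _; rewrite -sqrtr_sqr.
by rewrite ler_wsqrtr// dotv_sqr_le.
Qed.

Lemma le_enorm_sqnorm u v a : 0 <= a ->
  enorm u <= a * enorm v -> sqnorm u <= a ^+ 2 * sqnorm v.
Proof.
move=> a0 uv; rewrite -!sqr_enorm -exprMn.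
by rewrite ler_sqr ?nnegrE ?mulr_ge0 ?enorm_ge0.
Qed.

End Vectors.

(** * Averages over clients and sums of squared deviations *)

Section Averages.
Context {R : realType} {d n : nat}.
Hypothesis n_gt0 : (0 < n)%N.
Implicit Types (u v : 'I_n -> 'rV[R]_d) (a : 'rV[R]_d).

Let nR0 : (n%:R : R) != 0. Proof. by rewrite pnatr_eq0 -lt0n. Qed.

Lemma avg_iterD u v : avg_iter (fun i => u i + v i) = avg_iter u + avg_iter v.
Proof. by rewrite /avg_iter -scalerDr -big_split. Qed.

Lemma avg_iterZ (b : R) u : avg_iter (fun i => b *: u i) = b *: avg_iter u.
Proof. by rewrite /avg_iter scalerA mulrC -scalerA; congr (_ *: _); rewrite scaler_sumr. Qed.

Lemma avg_iterB u v : avg_iter (fun i => u i - v i) = avg_iter u - avg_iter v.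
Proof. by rewrite /avg_iter sumrB scalerBr. Qed.

Lemma avg_iter_cst a : avg_iter (fun _ : 'I_n => a) = a.
Proof. by rewrite /avg_iter sumr_const card_ord -[a *+ n]scaler_nat scalerA mulVf// scale1r. Qed.

(** Parallel axis identity: the deviations from the average sum to zero, so the cross term
    disappears. *)
Lemma sum_sub_avg u a :
  \sum_(i < n) sqnorm (u i - a) =
  \sum_(i < n) sqnorm (u i - avg_iter u) + n%:R * sqnorm (avg_iter u - a).
Proof.
have H i : sqnorm (u i - a) = sqnorm (u i - avg_iter u) +
    2 * dotv (u i - avg_iter u) (avg_iter u - a) + sqnorm (avg_iter u - a).
  by rewrite -sqnormD addrA subrK.
under eq_bigr do rewrite H.
rewrite 2!big_split/= -mulr_sumr -dotv_suml sumrB.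
rewrite sumr_const card_ord.
have -> : \sum_(i < n) u i - avg_iter u *+ n = 0.
  by rewrite -[avg_iter u *+ n]scaler_nat /avg_iter scalerA mulfV// scale1r subrr.
by rewrite dotv0l mulr0 addr0 sumr_const card_ord mulr_natl.
Qed.

Lemma sum_sub_avg_le u a :
  \sum_(i < n) sqnorm (u i - avg_iter u) <= \sum_(i < n) sqnorm (u i - a).
Proof. by rewrite (sum_sub_avg u a) lerDl mulr_ge0// sqnorm_ge0. Qed.

(** Jensen for the square: [sum_sub_avg] around 0, with the sum of deviations dropped. *)
Lemma sqnorm_avg_le u : sqnorm (avg_iter u) <= n%:R^-1 * \sum_(i < n) sqnorm (u i).
Proof.
have := sum_sub_avg u 0; rewrite subr0.
under eq_bigr do rewrite subr0.
move=> ->; rewrite mulrDr mulrA mulVf// mul1r lerDr.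
by rewrite mulr_ge0// ?invr_ge0// sumr_ge0// => i _; exact: sqnorm_ge0.
Qed.

Lemma sqnorm_avgE u : sqnorm (avg_iter u) =
  n%:R ^- 2 * \sum_(i < n) \sum_(j < n) dotv (u i) (u j).
Proof.
rewrite sqnormZ exprVn /sqnorm dotv_suml; congr (_ * _).
by apply: eq_bigr => i _; rewrite dotv_sumr.
Qed.

End Averages.

(** * Consequences of a Lipschitz gradient *)

Section Smooth.
Context {R : realType} {d : nat}.
Implicit Types (f : 'rV[R]_d -> R) (x y v : 'rV[R]_d) (L : R).

Lemma diff_gradient f x v : differentiable f x -> 'd f x v = dotv (gradient f x) v.
Proof.
move=> df; rewrite {1}[v]row_sum_delta linear_sum; apply: eq_bigr => j _.
by rewrite linearZ mxE mulrC.
Qed.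

Lemma is_derive_line f x v (s : R) : (forall z, differentiable f z) ->
  is_derive s 1 (fun s => f (x + s *: v)) (dotv (gradient f (x + s *: v)) v).
Proof.
move=> df.
have dl : is_diff s (fun s : R => x + s *: v) (fun h => h *: v).
  by apply: is_diff_eq; apply/funext => h; rewrite /GRing.add/= add0r.
have dc : is_diff s (fun s => f (x + s *: v)) (fun h => 'd f (x + s *: v) (h *: v)).
  by apply: (@is_diff_comp _ _ _ _ _ _ f); apply: DiffDef.
apply: DeriveDef; first by apply: diff_derivable; exact: ex_diff.
by rewrite deriveE ?diff_val ?scale1r ?diff_gradient//; exact: ex_diff.
Qed.

(** Mean value theorem for [f] on the segment minus the quadratic [s * a + s ^+ 2 * b]. The value
    [b = L / 2 * sqnorm v] makes the derivative of this difference nonpositive, by Cauchy-Schwarz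
    and the Lipschitz bound at distance [s * enorm v]. *)
Lemma descent f L x y : (forall z, differentiable f z) -> 0 <= L ->
  (forall x y, enorm (gradient f y - gradient f x) <= L * enorm (y - x)) ->
  f y <= f x + dotv (gradient f x) (y - x) + L / 2 * sqnorm (y - x).
Proof.
move=> df L0 lip; set v := y - x; set a := dotv (gradient f x) v; set b := L / 2 * sqnorm v.
pose h (s : R) := f (x + s *: v) - (s * a + s ^+ 2 * b).
have dh (s : R) : is_derive s (1 : R) h (dotv (gradient f (x + s *: v)) v - (a + 2 * s * b)).
  have D := is_derive_line x v s df.
  have D2 : is_derive s (1 : R) (fun s : R => s * a + s ^+ 2 * b) (a + 2 * s * b).
    by apply: is_derive_eq; rewrite !scaler0 !add0r /GRing.scale/=; ring.
  exact: is_deriveB.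
have ch : {within `[0, 1], continuous h}.
  by apply: derivable_within_continuous => z _; exact: ex_derive.
have [c c01] := @MVT R h _ 0 1 ltr01 (fun s _ => dh s) ch.
rewrite subr0 mulr1 => expect.
suff : dotv (gradient f (x + c *: v)) v - (a + 2 * c * b) <= 0.
  rewrite -expect /h !scale0r !scale1r addr0 !mul0r expr0n/= mul0r addr0 subr0 expr1n.
  have -> : x + v = y by rewrite /v addrC subrK.
  by rewrite !mul1r; lra.
have c0 : 0 <= c by move: c01; rewrite in_itv/= => /andP[/ltW].
have gen (p q w : R) : p - q <= L * c * w -> p - (q + 2 * c * (L / 2 * w)) <= 0.
  by lra.
rewrite /b; apply: gen; rewrite /a -dotvBl.
apply: le_trans (dotv_le_enorm _ _) _.
apply: le_trans (ler_wpM2r (enorm_ge0 _) (lip _ _)) _.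
rewrite addrAC subrr add0r {1}/enorm sqnormZ sqrtrM ?sqr_ge0// sqrtr_sqr ger0_norm//.
by rewrite -/(enorm v) -sqr_enorm expr2 !mulrA.
Qed.

(** One gradient step of length [L^-1] lowers [f] by at least [sqnorm (gradient f x) / (2 * L)], and
    cannot go below [l]. *)
Lemma sqnorm_gradient_le f L l x : (forall z, differentiable f z) -> 0 < L ->
  (forall x y, enorm (gradient f y - gradient f x) <= L * enorm (y - x)) ->
  (forall z, l <= f z) -> sqnorm (gradient f x) <= 2 * L * (f x - l).
Proof.
move=> df L0 lip lf; have := descent x (x - L^-1 *: gradient f x) df (ltW L0) lip.
have -> : x - L^-1 *: gradient f x - x = - (L^-1 *: gradient f x) by rewrite addrAC subrr add0r.
rewrite dotvNr dotvZr sqnormN sqnormZ -/(sqnorm _).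
have := lf (x - L^-1 *: gradient f x); set z := f (_ - _); set q := sqnorm _ => lz H.
have -> : q = 2 * L * (L^-1 * q - L / 2 * (L^-1 ^+ 2 * q)) by field; rewrite gt_eqF.
by rewrite ler_pM2l ?mulr_gt0//; lra.
Qed.

End Smooth.

(** * Gradient of a scaled finite sum *)

Section Mean.
Context {R : realType} {d n : nat}.

Lemma gradient_mean (F : 'I_n -> 'rV[R]_d -> R) (a : R) x :
  (forall i, differentiable (F i) x) ->
  differentiable (fun y => a * \sum_(i < n) F i y) x /\
  gradient (fun y => a * \sum_(i < n) F i y) x = a *: \sum_(i < n) gradient (F i) x.
Proof.
move=> dF.
have -> : (fun y => a * \sum_(i < n) F i y) = a *: (\sum_(i < n) F i).
  by apply/funext => y; rewrite /GRing.scale/= fct_sumE.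
have ds := differentiable_sum dF.
split; first exact: differentiableZ.
apply/rowP => j; rewrite !mxE summxE diffZ//=; congr (_ * _).
under [RHS]eq_bigr do rewrite mxE.
rewrite -deriveE// derive_sum; last by move=> i; exact: diff_derivable.
by apply: eq_bigr => i _; rewrite deriveE.
Qed.

End Mean.

(** * Joint measurability of functions continuous in the state and measurable in the sample *)

Section Caratheodory.
Context {R : realType} {d : nat} {dZ dW : measure_display}.
Context {Z : measurableType dZ} {W : measurableType dW}.

Lemma measurable_caratheodory (g : 'rV[R]_d -> W -> R) (X : Z -> 'rV[R]_d) (Y : Z -> W) :
  (forall x, measurable_fun setT (g x)) -> (forall w, continuous (g^~ w)) ->
  (forall j, measurable_fun setT (fun z => X z 0 j)) -> measurable_fun setT Y ->
  measurable_fun setT (fun z => g (X z) (Y z)).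
Proof.
move=> mg cg mX mY.
(* X is rounded to the lattice of mesh 1/(k+1), which takes countably many values. *)
pose q k (m : 'rV[int]_d) : 'rV[R]_d := \row_j ((m 0 j)%:~R / k.+1%:R).
pose c k z : 'rV[int]_d := \row_j Num.floor (k.+1%:R * X z 0 j).
apply: (@measurable_realfun.measurable_fun_cvg _ _ _ _ (fun k z => g (q k (c k z)) (Y z))).
  move=> k _ B mB; rewrite setTI.
  have -> : (fun z => g (q k (c k z)) (Y z)) @^-1` B =
      \bigcup_m ([set z | c k z = m] `&` (fun z => g (q k m) (Y z)) @^-1` B).
    apply/seteqP; split => [z Bz|z [m _ [/= <-//]]].
    by exists (c k z).
  apply: countable_bigcupT_measurable; first exact: countableP.
  move=> m; apply: measurableI; last first.
    by rewrite -[X in measurable X]setTI; apply: measurableT_comp => //; exact: mg.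
  have -> : [set z | c k z = m] = \bigcap_(j in [set: 'I_d])
      ((fun z => k.+1%:R * X z 0 j) @^-1` `[(m 0 j)%:~R, (m 0 j + 1)%:~R[).
    apply/seteqP; split => [z /= <- j _ /=|z /= H].
      by rewrite !mxE in_itv/= Num.Theory.floor_itv.
    apply/rowP => j; rewrite mxE; apply/eqP.
    have := H j Logic.I; rewrite /= in_itv/= => ?.
    by rewrite Num.Theory.floor_eq.
  apply: fin_bigcap_measurable => [|j _]; first exact: finite_finset.
  rewrite -[X in measurable X]setTI; apply: measurable_funM => //.
move=> z _; apply: (@cvg_comp _ _ _ (fun k => q k (c k z)) (g^~ (Y z)) _ (nbhs (X z))); last exact: cg.
apply/cvg_ballP => e e0; near=> k; split=> // i j.
rewrite ord1 /q /c !mxE /ball/= .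
have k0 : (0 : R) < k.+1%:R by [].
set x := X z 0 j.
have /andP[a b] := Num.Theory.floor_itv (k.+1%:R * x).
have -> : x - (Num.floor (k.+1%:R * x))%:~R / k.+1%:R =
  (k.+1%:R * x - (Num.floor (k.+1%:R * x))%:~R) / k.+1%:R.
  by field; rewrite gt_eqF.
rewrite ger0_norm ?divr_ge0 ?subr_ge0//.
apply: (@le_lt_trans _ _ (k.+1%:R^-1)).
  rewrite ler_pdivrMr// mulVf ?gt_eqF//.
  by move: b; rewrite intrD; lra.
near: k; exact: near_infty_natSinv_lt (PosNum e0).
Unshelve. all: by end_near.
Qed.

End Caratheodory.

(** * Integrating out an independent variable *)

Section Freezing.
Context {R : realType} {dO dZ dW : measure_display}.
Context {Om : measurableType dO} {Z : measurableType dZ} {W : measurableType dW}.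
Variables (P : probability Om R) (Q : probability W R) (X : Om -> Z) (Y : Om -> W).
Hypotheses (mX : measurable_fun setT X) (mY : measurable_fun setT Y).
Hypothesis indep : forall A B, measurable A -> measurable B ->
  (P (X @^-1` A `&` Y @^-1` B) = P (X @^-1` A) * Q B)%E.

Let Xm : {mfun Om >-> Z} := HB.pack X (isMeasurableFun.Build _ _ _ _ _ mX).
Let XYm : {mfun Om >-> (Z * W)%type} :=
  HB.pack (fun w => (X w, Y w))
    (isMeasurableFun.Build _ _ _ _ _ (measurable_fun_pair mX mY)).

(** A product measure is determined by its values on rectangles, where [indep] gives them. *)
Let law A : measurable A ->
  distribution P XYm A = (distribution P Xm \x Q)%E A.
Proof.
move=> mA; apply/esym; apply: product_measure_unique => // B C mB mC; exact: indep.
Qed.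

(** Tonelli for the product law of [(X, Y)]: [X] is held fixed while [Y] is averaged under its law
    [Q]. *)
Lemma freeze_ge0 (H : Z * W -> \bar R) : measurable_fun setT H -> (forall x, 0 <= H x)%E ->
  (\int[P]_w H (X w, Y w) = \int[P]_w \int[Q]_s H (X w, s))%E.
Proof.
move=> mH H0.
rewrite -(ge0_integral_distribution XYm mH H0).
rewrite (eq_measure_integral (distribution P Xm \x Q)%E); last first.
  by move=> A mA _; exact: law.
rewrite fubini_tonelli1// ge0_integral_distribution//.
  exact: measurable_fun_fubini_tonelli_F.
by move=> z; apply: integral_ge0.
Qed.

(** The signed counterpart: integrability permits Fubini, and every inner integral is zero. *)
Lemma freeze_eq0 (H : Z * W -> R) : measurable_fun setT H ->
  P.-integrable setT (fun w => (H (X w, Y w))%:E) ->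
  (forall z, \int[Q]_s (H (z, s))%:E = 0)%E ->
  (\int[P]_w (H (X w, Y w))%:E = 0)%E.
Proof.
move=> mH iH H0.
have mH' : measurable_fun setT (EFin \o H) by exact/measurable_EFinP.
rewrite -(@integral_distribution _ _ _ _ _ P XYm (EFin \o H))//.
have iH' : (distribution P XYm).-integrable setT (EFin \o H).
  exact: (@integrable_pushforward _ _ _ _ _ _ (measurable_funP XYm)).
rewrite (eq_measure_integral (distribution P Xm \x Q)%E); last first.
  by move=> A mA _; exact: law.
rewrite -integral12_prod_meas1; last first.
  apply/integrableP; split=> //; case/integrableP: iH' => _.
  rewrite (eq_measure_integral (distribution P Xm \x Q)%E)// => A mA _; exact: law.
by apply: integral0_eq => z _; exact: H0.
Qed.

End Freezing.

(** * Independence of one variable from the sigma-algebra of all others *)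

Section Independence.
Context {R : realType} {dP : measure_display} {Om : measurableType dP}.
Context {P : probability Om R} {I : eqType} {dT : I -> measure_display}.
Context {T : forall k, measurableType (dT k)} {X : forall k, Om -> T k}.
Hypothesis mX : forall k, measurable_fun setT (X k).
Hypothesis indX : mutually_independent P X.

(* Events determined by finitely many of the X k with k != k0. *)
Definition cylinders_off (k0 : I) : set (set Om) :=
  [set B | exists J : seq I, exists A : forall k, set (T k),
     [/\ uniq J, k0 \notin J, forall k, measurable (A k) &
         B = \bigcap_(k in [set` J]) (X k @^-1` A k)]].

Definition sigma_off k0 := g_sigma_algebraType (cylinders_off k0).

Lemma cylinders_off_measurable k0 : cylinders_off k0 `<=` measurable.
Proof.
move=> _ [J [A [_ _ mA ->]]]; apply: fin_bigcap_measurable => [|k _]; first exact: finite_seq.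
by rewrite -[X in measurable X]setTI; exact: mX.
Qed.

Lemma cylinders_off_setI k0 : setI_closed (cylinders_off k0).
Proof.
move=> _ _ [J1 [A1 [u1 n1 m1 ->]]] [J2 [A2 [u2 n2 m2 ->]]].
(* An index in only one of the two lists is constrained by that family alone; the other contributes
   the whole space. *)
exists (undup (J1 ++ J2)), (fun k => (if k \in J1 then A1 k else setT) `&`
                              (if k \in J2 then A2 k else setT)).
split; first exact: undup_uniq.
- by rewrite mem_undup mem_cat negb_or n1.
- by move=> k; apply: measurableI; case: ifP.
apply/seteqP; split => w /=.
  move=> [H1 H2] k /=; rewrite mem_undup mem_cat => _.
  by split; case: ifP => // ?; [exact: H1|exact: H2].
move=> H; split => k /= kJ.
  by have [] := H k; rewrite /= ?mem_undup ?mem_cat kJ.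
by have [] := H k; rewrite /= ?mem_undup ?mem_cat kJ ?orbT.
Qed.

Lemma cylinders_offT k0 : cylinders_off k0 setT.
Proof.
exists [::], (fun=> setT); split=> //.
by rewrite set_nil bigcap_set0.
Qed.

Lemma sigma_off_sub k0 : measurable_fun setT (id : Om -> sigma_off k0).
Proof.
move=> _ B mB; rewrite setTI preimage_id.
by move: B mB; apply: smallest_sub; [exact: sigma_algebra_measurable|exact: cylinders_off_measurable].
Qed.

Lemma measurable_off k0 k : k != k0 ->
  measurable_fun setT (X k : sigma_off k0 -> T k).
Proof.
move=> kk0 _ B mB; rewrite setTI; apply: sub_sigma_algebra.
exists [:: k], (@eqtype.dfwith _ (fun k => set (T k)) (fun=> setT) k B); split=> //.
- by rewrite inE eq_sym.
- by move=> i; case: eqtype.dfwithP.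
- by rewrite set_cons1 bigcap_set1 dfwith_in.
Qed.

(** Uniqueness of finite measures on a pi-system. Restricting [P] to the event on [X k0] and scaling
    [P] by the probability of that event give two measures, which agree on cylinders by mutual
    independence along [k0 :: J]. *)
Lemma independent_off k0 (B : set (sigma_off k0)) C :
  measurable B -> measurable C ->
  (P (B `&` X k0 @^-1` C) = P B * P (X k0 @^-1` C))%E.
Proof.
move=> mB mC.
have mC' : measurable (X k0 @^-1` C).
  by rewrite -[X in measurable X]setTI; exact: mX.
pose r : {nonneg R} := NngNum (fine_ge0 (measure_ge0 P (X k0 @^-1` C))).
have rE : (r%:num%:E = P (X k0 @^-1` C))%E by apply: fineK; exact: fin_num_measure.
pose m1 : {measure set Om -> \bar R} := mrestr P mC'.
pose m2 : {measure set Om -> \bar R} := mscale r P.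
suff -> : P (B `&` X k0 @^-1` C) = m2 B.
  by rewrite /m2/= /mscale rE muleC.
rewrite -[LHS]/(m1 B).
apply: (g_sigma_algebra_measure_unique (cylinders_off k0) (@cylinders_off_measurable k0)
  (fun=> setT)) => //.
- by move=> _; exact: cylinders_offT.
- by rewrite bigcup_const.
- exact: cylinders_off_setI.
- move=> _ [J [A [uJ nJ mA ->]]].
  rewrite /m1 /m2/= /mrestr /mscale rE.
  (* A single family of events carries [C] at [k0] and agrees with [A] on [J]. *)
  have mA' k : measurable (@eqtype.dfwith _ (fun k => set (T k)) A k0 C k) by case: eqtype.dfwithP.
  have := @indX (k0 :: J) _ _ mA'; rewrite /= nJ uJ => /(_ isT).
  rewrite big_cons dfwith_in.
  have AE k : k \in J -> @eqtype.dfwith _ (fun k => set (T k)) A k0 C k = A k.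
    by move=> kJ; rewrite dfwith_out//; apply: contraNneq nJ => ->.
  rewrite (eq_big_seq (fun k => P (X k @^-1` A k))); last by move=> k /AE ->.
  rewrite -(indX uJ mA) => <-; congr (P _).
  apply/seteqP; split => w /=.
    move=> [H1 H2] k /=; rewrite inE => /predU1P[->|kJ]; first by rewrite dfwith_in.
    by rewrite AE//; exact: H1.
  move=> H; split; last by have := H k0; rewrite /= mem_head dfwith_in; apply.
  by move=> k /= kJ; have := H k; rewrite /= inE kJ orbT AE//; apply.
- by move=> _; rewrite /m1 /mrestr (le_lt_trans (probability_le1 _ _))// ?ltry//; apply: measurableI.
Qed.

End Independence.

(** * Expectations and square-integrable random vectors *)

Section SquareIntegrable.
Context {R : realType} {dO : measure_display} {Om : measurableType dO}.
Variable P : probability Om R.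
Implicit Types X Y : Om -> R.

Definition intgr X := P.-integrable setT (EFin \o X).
Definition L2 X := measurable_fun setT X /\ intgr (fun w => X w ^+ 2).
Definition expect X := Rintegral P setT X.

Lemma intgr_measurable X : intgr X -> measurable_fun setT X.
Proof. by move=> /integrableP[/measurable_EFinP]. Qed.

Lemma intgr_cst (a : R) : intgr (cst a).
Proof. exact: finite_measure_integrable_cst. Qed.

Lemma intgrD X Y : intgr X -> intgr Y -> intgr (fun w => X w + Y w).
Proof. by move=> iX iY; exact: (@integrableD _ _ _ P setT measurableT (EFin \o X) (EFin \o Y)). Qed.

Lemma intgrZ (a : R) X : intgr X -> intgr (fun w => a * X w).
Proof. by move=> iX; exact: (@integrableZl _ _ _ P setT measurableT a (EFin \o X)). Qed.

Lemma intgrB X Y : intgr X -> intgr Y -> intgr (fun w => X w - Y w).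
Proof. by move=> iX iY; exact: (@integrableB _ _ _ P setT measurableT (EFin \o X) (EFin \o Y)). Qed.

Lemma intgr_sum n (X : 'I_n -> Om -> R) : (forall i, intgr (X i)) ->
  intgr (fun w => \sum_(i < n) X i w).
Proof.
move=> iX; have : P.-integrable setT (fun w => \sum_(i < n) (EFin \o X i) w)%E.
  by apply: integrable_sum => // i _; exact: iX.
by apply: eq_integrable => // w _; rewrite sumEFin.
Qed.

Lemma intgr_le X Y : measurable_fun setT X -> (forall w, `|X w| <= Y w) ->
  intgr Y -> intgr X.
Proof.
move=> mX XY; apply: le_integrable => //; first exact/measurable_EFinP.
by move=> w _; rewrite lee_fin (le_trans (XY w))// ler_norm.
Qed.

Lemma eq_E X Y : X =1 Y -> expect X = expect Y.
Proof. by move=> /funext ->. Qed.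

Lemma E_cst (a : R) : expect (fun=> a) = a.
Proof. rewrite /expect Rintegral_cst// -[RHS]mulr1; congr (_ * _).
exact: (congr1 fine (probability_setT P)). Qed.

Lemma ED X Y : intgr X -> intgr Y -> expect (fun w => X w + Y w) = expect X + expect Y.
Proof. by move=> *; exact: RintegralD. Qed.

Lemma EB X Y : intgr X -> intgr Y -> expect (fun w => X w - Y w) = expect X - expect Y.
Proof. by move=> *; exact: RintegralB. Qed.

Lemma EZ (a : R) X : intgr X -> expect (fun w => a * X w) = a * expect X.
Proof. by move=> *; exact: RintegralZl. Qed.

Lemma E_sum n (X : 'I_n -> Om -> R) : (forall i, intgr (X i)) ->
  expect (fun w => \sum_(i < n) X i w) = \sum_(i < n) expect (X i).
Proof.
elim: n X => [|n IH] X iX.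
  rewrite big_ord0 -[RHS](E_cst 0); apply: eq_E => w; exact: big_ord0.
rewrite big_ord_recr/= -IH// -ED//; last exact: intgr_sum.
by apply: eq_E => w; rewrite big_ord_recr.
Qed.

Lemma le_E X Y : intgr X -> intgr Y -> (forall w, X w <= Y w) -> expect X <= expect Y.
Proof. by move=> iX iY XY; apply: le_Rintegral. Qed.

Lemma E_integral X : intgr X -> (\int[P]_w (X w)%:E)%E = (expect X)%:E.
Proof. by move=> iX; rewrite fineK//; exact: integrable_fin_num. Qed.

Lemma L2_le X Y : measurable_fun setT X -> (forall w, X w ^+ 2 <= Y w) ->
  intgr Y -> L2 X.
Proof.
move=> mX XY iY; split=> //; apply: intgr_le iY.
  exact: measurable_funX.
by move=> w; rewrite ger0_norm ?sqr_ge0.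
Qed.

Lemma L2_cst (a : R) : L2 (cst a).
Proof. by split; [exact: measurable_cst|exact: (intgr_cst (a ^+ 2))]. Qed.

Lemma L2D X Y : L2 X -> L2 Y -> L2 (fun w => X w + Y w).
Proof.
move=> [mX iX] [mY iY].
apply: (@L2_le _ (fun w => 2 * X w ^+ 2 + 2 * Y w ^+ 2)).
- exact: measurable_funD.
- move=> w; have := sqr_ge0 (X w - Y w); rewrite sqrrB sqrrD; lra.
- by apply: intgrD; exact: intgrZ.
Qed.

Lemma L2Z (a : R) X : L2 X -> L2 (fun w => a * X w).
Proof.
move=> [mX iX]; apply: (@L2_le _ (fun w => a ^+ 2 * X w ^+ 2)).
- by apply: measurable_funM.
- by move=> w; rewrite exprMn.
- exact: intgrZ.
Qed.

Lemma L2_mul X Y : L2 X -> L2 Y -> intgr (fun w => X w * Y w).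
Proof.
move=> [mX iX] [mY iY]; apply: (@intgr_le _ (fun w => X w ^+ 2 + Y w ^+ 2)).
- exact: measurable_funM.
- move=> w; rewrite ler_norml.
  have := sqr_ge0 (X w - Y w); have := sqr_ge0 (X w + Y w); rewrite sqrrB sqrrD.
  have := sqr_ge0 (X w); have := sqr_ge0 (Y w).
  by move=> *; apply/andP; split; lra.
- exact: intgrD.
Qed.

Context {d : nat}.
Implicit Types U V : Om -> 'rV[R]_d.

(** Measurability and square integrability of vectors are taken coordinatewise, so that only real
    functions have to be integrated. *)
Definition vmeas {dT} {T : measurableType dT} (U : T -> 'rV[R]_d) :=
  forall j, measurable_fun setT (fun w => U w 0 j).
Definition vL2 U := forall j, L2 (fun w => U w 0 j).

Lemma vmeas_dotv {dT} {T : measurableType dT} (U V : T -> 'rV[R]_d) :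
  vmeas U -> vmeas V -> measurable_fun setT (fun w => dotv (U w) (V w)).
Proof.
by move=> mU mV; apply: measurable_sum => j; apply: measurable_funM.
Qed.

Lemma vL2_meas U : vL2 U -> vmeas U.
Proof. by move=> U2 j; have [] := U2 j. Qed.

Lemma vL2_cst (a : 'rV[R]_d) : vL2 (fun=> a).
Proof. by move=> j; exact: L2_cst. Qed.

Lemma vL2D U V : vL2 U -> vL2 V -> vL2 (fun w => U w + V w).
Proof.
move=> U2 V2 j.
have -> : (fun w => (U w + V w) 0 j) = (fun w => U w 0 j + V w 0 j).
  by apply/funext => w; rewrite mxE.
exact: L2D.
Qed.

Lemma vL2Z (a : R) U : vL2 U -> vL2 (fun w => a *: U w).
Proof.
move=> U2 j.
have -> : (fun w => (a *: U w) 0 j) = (fun w => a * U w 0 j).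
  by apply/funext => w; rewrite mxE.
exact: L2Z.
Qed.

Lemma vL2B U V : vL2 U -> vL2 V -> vL2 (fun w => U w - V w).
Proof.
move=> U2 V2.
have -> : (fun w => U w - V w) = (fun w => U w + -1 *: V w).
  by apply/funext => w; rewrite scaleN1r.
by apply: vL2D => //; exact: vL2Z.
Qed.

Lemma vL2_sum n (U : 'I_n -> Om -> 'rV[R]_d) : (forall i, vL2 (U i)) ->
  vL2 (fun w => \sum_(i < n) U i w).
Proof.
elim: n U => [|n IH] U U2.
  have -> : (fun w => \sum_(i < 0) U i w) = (fun=> 0).
    by apply/funext => w; rewrite big_ord0.
  exact: vL2_cst.
have -> : (fun w => \sum_(i < n.+1) U i w) =
    (fun w => \sum_(i < n) U (widen_ord (leqnSn n) i) w + U ord_max w).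
  by apply/funext => w; rewrite big_ord_recr.
by apply: vL2D => //; exact: IH.
Qed.

Lemma vL2_avg n (U : 'I_n -> Om -> 'rV[R]_d) : (forall i, vL2 (U i)) ->
  vL2 (fun w => avg_iter (fun i => U i w)).
Proof. by move=> U2; apply: vL2Z; exact: vL2_sum. Qed.

Lemma vL2_dotv U V : vL2 U -> vL2 V -> intgr (fun w => dotv (U w) (V w)).
Proof. by move=> U2 V2; apply: intgr_sum => j; exact: L2_mul. Qed.

Lemma vL2_sqnorm U : vL2 U -> intgr (fun w => sqnorm (U w)).
Proof. by move=> U2; exact: vL2_dotv. Qed.

Lemma vL2_le U Y : vmeas U -> (forall w, sqnorm (U w) <= Y w) -> intgr Y -> vL2 U.
Proof.
move=> mU UY iY j; apply: (@L2_le _ Y) => // w.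
exact: le_trans (coord_sqr_le _ _) (UY w).
Qed.

End SquareIntegrable.

(** * Lipschitz maps for the Euclidean norm *)

Section Lipschitz.
Context {R : realType} {d : nat}.
Implicit Types (x y : 'rV[R]_d) (L : R).

Definition lipv L (g : 'rV[R]_d -> 'rV[R]_d) :=
  forall x y, enorm (g y - g x) <= L * enorm (y - x).

Lemma normr_coord_le (u : 'rV[R]_d) j : `|u 0 j| <= enorm u.
Proof. by rewrite -sqrtr_sqr ler_wsqrtr// coord_sqr_le. Qed.

Lemma lip_continuous L (g : 'rV[R]_d -> R) : 0 < L ->
  (forall x y, `|g y - g x| <= L * enorm (y - x)) -> continuous g.
Proof.
move=> L0 lip x; apply/(@cvgrPdist_lt R R _ (nbhs x) (nbhs_filter x) g (g x)) => e e0.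
(* Balls are taken in the max-norm: coordinates below [del] give Euclidean norm at most
   [d%:R * del]. The factor [d.+1] makes this strictly less than [e / L], also for [d = 0]. *)
pose del := e / (L * d.+1%:R).
have del0 : 0 < del by rewrite divr_gt0// mulr_gt0.
have bx : \forall y \near x, ball x del y by exact: nbhsx_ballx.
near=> y.
have [_ xy'] : ball x del y by near: y; exact: bx.
have xy j : `|x 0 j - y 0 j| < del by exact: xy'.
rewrite (le_lt_trans (lip y x))// -ltr_pdivlMl//.
have : sqnorm (x - y) <= (d%:R * del) ^+ 2.
  apply: (@le_trans _ _ (\sum_(j < d) del ^+ 2)).
    apply: ler_sum => j _; rewrite -expr2 !mxE -real_normK ?num_real//.
    by rewrite ler_sqr ?nnegrE// ?ltW.
  rewrite sumr_const card_ord -[leLHS]mulr_natl [leRHS]exprMn ler_wpM2r ?sqr_ge0//.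
  by rewrite -natrX ler_nat -{1}(expn1 d); case: (d) => // m; rewrite leq_pexp2l.
have dd0 : 0 <= d%:R * del by apply: mulr_ge0 => //; exact: ltW.
rewrite -sqr_enorm ler_sqr ?nnegrE ?enorm_ge0 ?dd0// => H.
apply: (le_lt_trans H); rewrite /del.
have -> : L^-1 * e = d.+1%:R * (e / (L * d.+1%:R)).
  have gen (a b c : R) : a != 0 -> b != 0 -> a^-1 * c = b * (c / (a * b)).
    by move=> ? ?; field; apply/andP.
  by apply: gen; rewrite ?gt_eqF.
by rewrite ltr_pM2r// ltr_nat.
Unshelve. all: by end_near.
Qed.

Lemma lipv_coord_continuous L g j : 0 < L -> lipv L g -> continuous (fun x => g x 0 j).
Proof.
move=> L0 lip; apply: (lip_continuous L0) => x y.
apply: le_trans _ (lip x y); apply: le_trans _ (normr_coord_le _ j).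
by rewrite !mxE.
Qed.

(** Linear growth, which transfers square integrability from the iterates to their gradients. *)
Lemma lipv_sqnorm_le L g x : 0 < L -> lipv L g ->
  sqnorm (g x) <= 2 * L ^+ 2 * sqnorm x + 2 * sqnorm (g 0).
Proof.
move=> L0 lip; rewrite -{1}(subrK (g 0) (g x)).
apply: le_trans (sqnormD_le _ _) _; rewrite lerD2r -mulrA ler_pM2l//.
by apply: le_enorm_sqnorm; [exact: ltW|]; have := lip 0 x; rewrite subr0.
Qed.

End Lipschitz.

(** * Lipschitz bound for the mean gradient *)

Section MeanLipschitz.
Context {R : realType} {d : nat} {dW : measure_display} {W : measurableType dW}.
Variables (Q : probability W R) (G : 'rV[R]_d -> W -> 'rV[R]_d) (h : 'rV[R]_d -> 'rV[R]_d).
Variable L : R.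
Hypothesis iG : forall x j, intgr Q (fun s => G x s 0 j).
Hypothesis Eh : forall x j, expect Q (fun s => G x s 0 j) = h x 0 j.
Hypothesis lipG : forall s, lipv L (G^~ s).

Lemma intgr_dotv_cst (u : 'rV[R]_d) x : intgr Q (fun s => dotv u (G x s)).
Proof. by apply: intgr_sum => j; exact: intgrZ. Qed.

Lemma E_dotv_cst (u : 'rV[R]_d) x : expect Q (fun s => dotv u (G x s)) = dotv u (h x).
Proof.
rewrite E_sum; last by move=> j; exact: intgrZ.
by apply: eq_bigr => j _; rewrite EZ// Eh.
Qed.

(** Testing the increment [u] of [h] against itself: [sqnorm u] is the mean of
    [dotv u (G y s - G x s)], hence at most [enorm u * (L * enorm (y - x))], and [enorm u]
    cancels. *)
Lemma lipv_mean : lipv L h.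
Proof.
move=> x y; set u := h y - h x.
have [u0|u0] := eqVneq (enorm u) 0.
  (* The right-hand side is nonnegative because it bounds a norm at the sample [point]. *)
  rewrite u0; have := lipG point x y; exact: le_trans (enorm_ge0 _).
have up : 0 < enorm u by rewrite lt_neqAle eq_sym u0 enorm_ge0.
rewrite -(ler_pM2l up) -expr2 sqr_enorm /sqnorm {2}/u dotvBr -!E_dotv_cst.
rewrite -EB; try exact: intgr_dotv_cst.
rewrite -[leRHS](E_cst Q); apply: le_E.
- by apply: intgrB; exact: intgr_dotv_cst.
- exact: intgr_cst.
- move=> s; rewrite -dotvBr; apply: le_trans (dotv_le_enorm _ _) _.
  by rewrite ler_wpM2l ?enorm_ge0//; exact: lipG.
Qed.

End MeanLipschitz.

(** * Measurability of Lipschitz images and averages *)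

Section LipMeas.
Context {R : realType} {d : nat} {dZ dW : measure_display}.
Context {Z : measurableType dZ} {W : measurableType dW}.

Lemma vmeas_lip2 (g : 'rV[R]_d -> W -> 'rV[R]_d) L (X : Z -> 'rV[R]_d) (Y : Z -> W) :
  0 < L -> (forall x, vmeas (g x)) -> (forall s, lipv L (g^~ s)) ->
  vmeas X -> measurable_fun setT Y -> vmeas (fun z => g (X z) (Y z)).
Proof.
move=> L0 mg lg mX mY j.
apply: (@measurable_caratheodory _ _ _ _ _ _ (fun x s => g x s 0 j)) => //.
- by move=> x; exact: mg.
- by move=> s; exact: (@lipv_coord_continuous _ _ L (g^~ s)).
Qed.

Lemma vmeas_lip (g : 'rV[R]_d -> 'rV[R]_d) L (X : Z -> 'rV[R]_d) :
  0 < L -> lipv L g -> vmeas X -> vmeas (fun z => g (X z)).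
Proof.
move=> L0 lg mX j.
apply: (@measurable_caratheodory _ _ _ _ _ _ (fun x _ => g x 0 j) X id) => //.
by move=> _; exact: (@lipv_coord_continuous _ _ L g j L0 lg).
Qed.

Lemma vmeasD (X Y : Z -> 'rV[R]_d) : vmeas X -> vmeas Y -> vmeas (fun z => X z + Y z).
Proof.
move=> mX mY j.
have -> : (fun w => (X w + Y w) 0 j) = (fun w => X w 0 j + Y w 0 j).
  by apply/funext => w; rewrite mxE.
exact: measurable_funD.
Qed.

Lemma vmeasZ a (X : Z -> 'rV[R]_d) : vmeas X -> vmeas (fun z => a *: X z).
Proof.
move=> mX j.
have -> : (fun w => (a *: X w) 0 j) = (fun w => a * X w 0 j).
  by apply/funext => w; rewrite mxE.
by apply: measurable_funM => //; exact: mX.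
Qed.

Lemma vmeasB (X Y : Z -> 'rV[R]_d) : vmeas X -> vmeas Y -> vmeas (fun z => X z - Y z).
Proof.
move=> mX mY.
have -> : (fun w => X w - Y w) = (fun w => X w + -1 *: Y w).
  by apply/funext => w; rewrite scaleN1r.
by apply: vmeasD => //; exact: vmeasZ.
Qed.

Lemma vmeas_avg n (X : 'I_n -> Z -> 'rV[R]_d) : (forall i, vmeas (X i)) ->
  vmeas (fun z => avg_iter (fun i => X i z)).
Proof.
move=> mX; apply: vmeasZ => j.
have -> : (fun z => (\sum_(i < n) X i z) 0 j) = (fun z => \sum_(i < n) X i z 0 j).
  by apply/funext => z; rewrite summxE.
by apply: measurable_sum => i; exact: mX.
Qed.

End LipMeas.

(** * FedAvg iterates along one sample path *)

Section Process.
Context {R : realType} {d n : nat} {Om : 'I_n -> Type}.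
Variables (tau : nat) (G : forall i, 'rV[R]_d -> Om i -> 'rV[R]_d).
Arguments G : clear implicits.
Variables (h : 'I_n -> 'rV[R]_d -> 'rV[R]_d) (gb : R) (x0 : 'rV[R]_d).
Hypothesis n_gt0 : (0 < n)%N.

Definition fedavg (s : nat -> forall i, Om i) t := fed_iter tau (fun _ _ _ => gb) G x0 s t.
Definition noise (s : nat -> forall i, Om i) t i :=
  G i (fedavg s t i) (s t i) - h i (fedavg s t i).
Definition center s t := avg_iter (fedavg s t).
Definition drift s t := avg_iter (fun i => h i (fedavg s t i)).
Definition spread s t := n%:R^-1 * \sum_(i < n) sqnorm (fedavg s t i - center s t).

(** Averaging at a communication round leaves the mean unchanged, so both branches of [fed_step]
    move the center alike. *)
Lemma centerS s t :
  center s t.+1 = center s t - gb *: (drift s t + avg_iter (noise s t)).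
Proof.
have -> : drift s t + avg_iter (noise s t) =
    avg_iter (fun i => G i (fedavg s t i) (s t i)).
  by rewrite -avg_iterD; congr avg_iter; apply/funext => i; rewrite addrC subrK.
rewrite -avg_iterZ -avg_iterB /center /fedavg /= /fed_step; case: ifP => // _.
by rewrite -[RHS](avg_iter_cst n_gt0).
Qed.

(** All clients hold the same point right after a communication round, and also at time 0, where
    they start from [x0]. *)
Lemma spread_sync s t : (tau %| t)%N -> spread s t = 0.
Proof.
have H a : n%:R^-1 * \sum_(i < n) sqnorm (a - avg_iter (fun _ : 'I_n => a)) = 0.
  rewrite avg_iter_cst// subrr sqnorm0 big1 ?mulr0//.
case: t => [|t] td; first exact: H.
by rewrite /spread /center /fedavg /= /fed_step td; exact: H.
Qed.

Lemma fedavgS s t i : ~~ (tau %| t.+1)%N ->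
  fedavg s t.+1 i = fedavg s t i - gb *: (h i (fedavg s t i) + noise s t i).
Proof.
move=> td; rewrite /fedavg /= /fed_step (negbTE td) -/(fedavg s t).
by rewrite /noise [h i _ + _]addrC subrK.
Qed.

End Process.

(** * Which samples the iterates and the noise depend on *)

Section ProcessMeasurability.
Context {R : realType} {d n : nat} {dO : 'I_n -> measure_display}.
Context {Om : forall i, measurableType (dO i)}.
Variables (tau : nat) (G : forall i, 'rV[R]_d -> Om i -> 'rV[R]_d).
Arguments G : clear implicits.
Variables (h : 'I_n -> 'rV[R]_d -> 'rV[R]_d) (L gb : R) (x0 : 'rV[R]_d).
Hypothesis L_gt0 : 0 < L.
Hypothesis mG : forall i x, vmeas (G i x).
Hypothesis lipG : forall i s, lipv L ((G i)^~ s).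
Hypothesis liph : forall i, lipv L (h i).
Context {dZ : measure_display} {Z : measurableType dZ} {xi : nat -> forall i, Z -> Om i}.
Let path z := fun t i => xi t i z.

(** Only samples drawn before [t] have to be measurable, and [Z] is arbitrary; hence this applies to
    the sample space with a sigma-algebra that omits a sample of round [t]. *)
Lemma vmeas_fedavg t : (forall r i, (r < t)%N -> measurable_fun setT (xi r i)) ->
  forall i, vmeas (fun z => fedavg tau G gb x0 (path z) t i).
Proof.
elim: t => [|t IH] mxi i; first by move=> j; exact: measurable_cst.
have {}IH := IH (fun r i rt => mxi r i (ltnW rt)).
have mstep k : vmeas (fun z => fedavg tau G gb x0 (path z) t k - gb *: G k (fedavg tau G gb x0 (path z) t k) (xi t k z)).
  apply: vmeasB => //; apply: vmeasZ.
  apply: (vmeas_lip2 L_gt0) => //; exact: mxi.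
rewrite /fedavg /= /fed_step; case: (tau %| t.+1)%N; last exact: mstep.
exact: (vmeas_avg mstep).
Qed.

(** Of round [t] only the client's own sample enters, so the noise stays measurable when the sample
    of another client is omitted. *)
Lemma vmeas_noise t i : (forall r i, (r < t)%N -> measurable_fun setT (xi r i)) ->
  measurable_fun setT (xi t i) -> vmeas (fun z => noise tau G h gb x0 (path z) t i).
Proof.
move=> mxi mti; have mX := vmeas_fedavg mxi.
apply: vmeasB; last by apply: (vmeas_lip L_gt0).
exact: (vmeas_lip2 L_gt0).
Qed.

End ProcessMeasurability.

(** * Pathwise inequalities for the descent and for the spread *)

Section Deterministic.
Context {R : realType} {d n : nat} {Om : 'I_n -> Type}.
Variables (tau : nat) (G : forall i, 'rV[R]_d -> Om i -> 'rV[R]_d).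
Variables (h : 'I_n -> 'rV[R]_d -> 'rV[R]_d) (L gb zeta : R) (x0 : 'rV[R]_d).
Hypotheses (n_gt0 : (0 < n)%N) (tau_gt0 : (0 < tau)%N) (L_gt0 : 0 < L) (gb_gt0 : 0 < gb).
Hypothesis gb_lt : gb < (25 * L * tau%:R)^-1.
Hypothesis liph : forall i, lipv L (h i).
Definition hbar x := avg_iter (fun i => h i x).
Hypothesis zetaP : forall x, n%:R^-1 * \sum_(i < n) sqnorm (h i x - hbar x) <= zeta ^+ 2.
Variable f : 'rV[R]_d -> R.
Hypothesis descf : forall x y, f y <= f x + dotv (hbar x) (y - x) + L / 2 * sqnorm (y - x).

Local Notation X := (fedavg tau G gb x0).
Local Notation eps := (noise tau G h gb x0).
Local Notation c := (center tau G gb x0).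
Local Notation b := (drift tau G h gb x0).
Local Notation V := (spread tau G gb x0).

Let nR_gt0 : (0 : R) < n%:R. Proof. by rewrite ltr0n. Qed.
Let nV_ge0 : (0 : R) <= n%:R^-1. Proof. by rewrite invr_ge0 ltW. Qed.
Let tauR_ge1 : (1 : R) <= tau%:R. Proof. by rewrite ler1n. Qed.

Lemma gbL_tau : gb * L * tau%:R <= 25^-1.
Proof.
have t0 : (0 : R) < tau%:R by rewrite ltr0n.
have : gb * (25 * L * tau%:R) <= 1.
  by rewrite -ler_pdivlMr ?mulr_gt0// mul1r ltW.
by move=> H; rewrite -(ler_pM2l (_ : 0 < 25))// mulfV//; lra.
Qed.

Lemma gbL_le1 : gb * L <= 1.
Proof.
have H : gb * L * 1 <= gb * L * tau%:R by rewrite ler_wpM2l// mulr_ge0// ltW.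
have := gbL_tau; lra.
Qed.

Lemma lip_sq i x y : sqnorm (h i y - h i x) <= L ^+ 2 * sqnorm (y - x).
Proof. by apply: le_enorm_sqnorm; [exact: ltW|exact: liph]. Qed.

(** Jensen takes the average out of the square; each client then contributes a Lipschitz error. *)
Lemma drift_err s t : sqnorm (hbar (c s t) - b s t) <= L ^+ 2 * V s t.
Proof.
rewrite /hbar /drift -avg_iterB; apply: le_trans (sqnorm_avg_le n_gt0 _) _.
rewrite mulrCA ler_wpM2l// mulr_sumr; apply: ler_sum => i _.
by rewrite sqnormBC; exact: lip_sq.
Qed.

(* The coefficient of the averaged noise in the descent inequality. *)
Definition descent_test s t := (L * gb ^+ 2) *: b s t - gb *: hbar (c s t).

(** Polarization turns the product of gradient [g] and drift [B] into
    [sqnorm g + sqnorm B - sqnorm (g - B)]. The last square is bounded by [drift_err], and the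
    negative [sqnorm B] absorbs the second-order term because [gb * L <= 1]. *)
Lemma descent_step s t :
  f (c s t.+1) <= f (c s t) - gb / 2 * sqnorm (hbar (c s t)) + gb / 2 * L ^+ 2 * V s t
     + dotv (descent_test s t) (avg_iter (eps s t)) + L / 2 * gb ^+ 2 * sqnorm (avg_iter (eps s t)).
Proof.
have := descf (c s t) (c s t.+1); rewrite (centerS _ _ h _ _ n_gt0).
set e := avg_iter _; set g := hbar _; set B := drift _ _ _ _ _ _ _; set x := center _ _ _ _ _ _.
have -> : x - gb *: (B + e) - x = - (gb *: (B + e)) by rewrite addrAC subrr add0r.
rewrite dotvNr dotvZr sqnormN sqnormZ sqnormD dotvDr.
rewrite /descent_test -/g -/B -/x dotvBl (dotvZl (L * gb ^+ 2) B) (dotvZl gb g).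
have := drift_err s t; rewrite -/g -/B -/x sqnormB.
have := sqnorm_ge0 B; have := gbL_le1; have := gb_gt0.
move: (V s t) (sqnorm g) (sqnorm B) (sqnorm e) (dotv g B) (dotv g e) (dotv B e) (f x) => v sg sB se gB ge Be fx.
move: (f _) => fy g0 gL sB0 H1 H2.
have H3 : gb / 2 * (sg - 2 * gB + sB) <= gb / 2 * (L ^+ 2 * v).
  by rewrite ler_wpM2l// divr_ge0// ltW.
have H4 : gb / 2 * sB * (gb * L) <= gb / 2 * sB * 1.
  by rewrite ler_wpM2l// mulr_ge0// divr_ge0// ltW.
apply: le_trans H2 _; rewrite -subr_ge0.
rewrite [X in 0 <= X](_ : _ = (gb / 2 * (L ^+ 2 * v) - gb / 2 * (sg - 2 * gB + sB)) +
    (gb / 2 * sB * 1 - gb / 2 * sB * (gb * L))); last first.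
  by field.
by rewrite addr_ge0// subr_ge0.
Qed.

(* The noiseless part of x_{t+1}^i - xb_{t+1} after a local step; it sums to 0 over i. *)
Definition local_step_dev s t i := X s t i - c s t - gb *: (h i (X s t i) - b s t).

Lemma spread_step s t : ~~ (tau %| t.+1)%N ->
  V s t.+1 <= (1 + 2 / tau%:R) * V s t + 4 * tau%:R * gb ^+ 2 * zeta ^+ 2 +
    n%:R^-1 * \sum_(i < n) (gb ^+ 2 * sqnorm (eps s t i) - 2 * gb * dotv (local_step_dev s t i) (eps s t i)).
Proof.
move=> td.
(* The mean minimizes the sum of squares, so it may be replaced by [c - gb *: b], which is free of
   the current noise. *)
have H1 : V s t.+1 <= n%:R^-1 * \sum_(i < n) sqnorm (local_step_dev s t i - gb *: eps s t i).
  rewrite ler_wpM2l//; apply: le_trans (sum_sub_avg_le n_gt0 _ (c s t - gb *: b s t)) _.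
  apply: ler_sum => i _; rewrite le_eqVlt; apply/orP; left; apply/eqP; congr sqnorm.
  rewrite (fedavgS _ h) // /local_step_dev; apply/rowP => j; rewrite !mxE; ring.
(* Recentring at [hbar (c s t)] splits each gradient deviation into a Lipschitz error and the
   heterogeneity at the center. *)
have H2 : \sum_(i < n) sqnorm (h i (X s t i) - b s t) <= n%:R * (2 * L ^+ 2 * V s t + 2 * zeta ^+ 2).
  apply: le_trans (sum_sub_avg_le n_gt0 _ (hbar (c s t))) _.
  apply: (@le_trans _ _ (\sum_(i < n) (2 * (L ^+ 2 * sqnorm (X s t i - c s t)) + 2 * sqnorm (h i (c s t) - hbar (c s t))))).
    apply: ler_sum => i _.
    have -> : h i (X s t i) - hbar (c s t) = (h i (X s t i) - h i (c s t)) + (h i (c s t) - hbar (c s t)).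
      by rewrite addrA subrK.
    by apply: le_trans (sqnormD_le _ _) _; rewrite lerD2r ler_pM2l//; exact: lip_sq.
  rewrite big_split/= -!mulr_sumr mulrDr; apply: lerD.
    rewrite /spread le_eqVlt; apply/orP; left; apply/eqP.
    by field; rewrite gt_eqF.
  rewrite mulrCA ler_pM2l// mulrC -ler_pdivrMr// mulrC; exact: zetaP.
(* Young with weight [tau]: the position keeps the factor [1 + 1/tau], the gradient part pays
   [1 + tau]. *)
have H3 : \sum_(i < n) sqnorm (local_step_dev s t i) <= (1 + tau%:R^-1) * (n%:R * V s t) +
    (1 + tau%:R) * (gb ^+ 2 * (n%:R * (2 * L ^+ 2 * V s t + 2 * zeta ^+ 2))).
  have -> : n%:R * V s t = \sum_(i < n) sqnorm (X s t i - c s t).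
    by rewrite /spread mulrA mulfV ?gt_eqF// mul1r.
  apply: (@le_trans _ _ (\sum_(i < n) ((1 + tau%:R^-1) * sqnorm (X s t i - c s t) + (1 + tau%:R) * (gb ^+ 2 * sqnorm (h i (X s t i) - b s t))))).
    apply: ler_sum => i _; rewrite -sqnormZ -[sqnorm (gb *: _)]sqnormN.
    by apply: sqnormD_young; rewrite ltr0n.
  rewrite big_split/= -!mulr_sumr lerD2l ler_wpM2l ?addr_ge0//.
  by rewrite ler_wpM2l ?sqr_ge0// -[n%:R * _]/(n%:R * _).
have H4 : \sum_(i < n) sqnorm (local_step_dev s t i - gb *: eps s t i) =
  \sum_(i < n) sqnorm (local_step_dev s t i) +
  \sum_(i < n) (gb ^+ 2 * sqnorm (eps s t i) - 2 * gb * dotv (local_step_dev s t i) (eps s t i)).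
  by rewrite -big_split; apply: eq_bigr => i _; rewrite sqnormB sqnormZ dotvZr /=; ring.
apply: le_trans H1 _; rewrite H4 mulrDr lerD2r.
apply: (@le_trans _ _ (n%:R^-1 * ((1 + tau%:R^-1) * (n%:R * V s t) +
    (1 + tau%:R) * (gb ^+ 2 * (n%:R * (2 * L ^+ 2 * V s t + 2 * zeta ^+ 2)))))).
  by rewrite ler_wpM2l.
have V0 : 0 <= V s t by rewrite mulr_ge0// sumr_ge0// => i _; exact: sqnorm_ge0.
move: (V s t) V0 gbL_tau (tauR_ge1) => v v0 gt t1.
have t0 : (0 : R) < tau%:R by rewrite ltr0n.
have n0 := nR_gt0.
move: (tau%:R : R) (n%:R : R) t0 n0 t1 gt => ta m t0 m0 t1 gt.
have gt0 : 0 <= gb * L * ta by rewrite !mulr_ge0// ltW.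
have gt2 : (gb * L * ta) ^+ 2 <= 1 / 4.
  apply: (@le_trans _ _ (25^-1 ^+ 2)); last by lra.
  by rewrite ler_sqr ?nnegrE// invr_ge0.
(* With [1 + ta <= 2 * ta] and the small step, the Lipschitz part of the gradient term costs only a
   second [1/tau]. *)
have K1 : (1 + ta) * (gb ^+ 2 * (2 * L ^+ 2)) <= ta^-1.
  rewrite -[leRHS]mul1r ler_pdivlMr//.
  apply: (@le_trans _ _ (4 * (gb * L * ta) ^+ 2)); last by lra.
  have -> : (1 + ta) * (gb ^+ 2 * (2 * L ^+ 2)) * ta = (1 + ta) * (2 * gb ^+ 2 * L ^+ 2 * ta) by ring.
  have -> : 4 * (gb * L * ta) ^+ 2 = (2 * ta) * (2 * gb ^+ 2 * L ^+ 2 * ta) by ring.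
  by rewrite ler_wpM2r ?mulr_ge0 ?(ltW t0) ?(ltW gb_gt0) ?(ltW L_gt0)//; lra.
have K2 : (1 + ta) * (gb ^+ 2 * (2 * L ^+ 2)) * v <= ta^-1 * v by rewrite ler_wpM2r.
have K3 : (1 + ta) * (2 * gb ^+ 2 * zeta ^+ 2) <= (2 * ta) * (2 * gb ^+ 2 * zeta ^+ 2).
  have p0 : 0 <= 2 * gb ^+ 2 * zeta ^+ 2.
    by apply: mulr_ge0; last exact: sqr_ge0; apply: mulr_ge0 => //; exact: sqr_ge0.
  by rewrite ler_wpM2r//; lra.
have -> : m^-1 * ((1 + ta^-1) * (m * v) + (1 + ta) * (gb ^+ 2 * (m * (2 * L ^+ 2 * v + 2 * zeta ^+ 2)))) =
  (1 + ta^-1) * v + (1 + ta) * (gb ^+ 2 * (2 * L ^+ 2)) * v + (1 + ta) * (2 * gb ^+ 2 * zeta ^+ 2).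
  by field; rewrite !gt_eqF.
have -> : (1 + 2 / ta) * v + 4 * ta * gb ^+ 2 * zeta ^+ 2 =
  (1 + ta^-1) * v + ta^-1 * v + (2 * ta) * (2 * gb ^+ 2 * zeta ^+ 2) by field; rewrite gt_eqF.
by rewrite lerD// lerD2l.
Qed.

End Deterministic.

(* Unlike ge0_le_integral, no measurability is needed: the gradient of F i is arbitrary
   off the support, so the iterates need only agree a.e. with measurable functions. *)
Lemma ge0_le_integral_nomeas {R : realType} {dT} {T : measurableType dT}
  (mu : {measure set T -> \bar R}) (f g : T -> \bar R) :
  (forall x, 0 <= f x)%E -> (forall x, f x <= g x)%E ->
  (\int[mu]_x f x <= \int[mu]_x g x)%E.
Proof.
move=> f0 fg; have g0 x : (0 <= g x)%E by exact: le_trans (f0 x) (fg x).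
rewrite !ge0_integralTE//; apply: ge_ereal_sup => _ [k kf <-].
by apply: ereal_sup_ubound; exists k => // x; exact: le_trans (kf x) (fg x).
Qed.

(** * Mean, variance and orthogonality of the noise *)

Section Expectation.
Context {R : realType} {d n : nat} {dO : 'I_n -> measure_display}.
Context {Om : forall i, measurableType (dO i)} {dP : measure_display}.
Context {Omega : measurableType dP}.
Variables (D : forall i, probability (Om i) R) (P : probability Omega R).
Variables (xi : nat -> forall i, Omega -> Om i).
Variables (tau : nat) (G : forall i, 'rV[R]_d -> Om i -> 'rV[R]_d).
Arguments G : clear implicits.
Arguments xi : clear implicits.
Variables (h : 'I_n -> 'rV[R]_d -> 'rV[R]_d) (L gb sigma : R) (x0 : 'rV[R]_d).
Hypotheses (n_gt0 : (0 < n)%N) (L_gt0 : 0 < L).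
Hypothesis lipG : forall i s, lipv L ((G i)^~ s).
Hypothesis iG : forall i x j, intgr (D i) (fun s => G i x s 0 j).
Hypothesis EG : forall i x j, expect (D i) (fun s => G i x s 0 j) = h i x 0 j.
Hypothesis varG : forall i x,
  (\int[D i]_s (sqnorm (G i x s - h i x))%:E <= (sigma ^+ 2)%:E)%E.
Hypothesis mxi : forall t i, measurable_fun setT (xi t i).
Hypothesis lawxi : forall t i A, measurable A -> P (xi t i @^-1` A) = D i A.
Let xik (k : nat * 'I_n) := xi k.1 k.2.
Hypothesis indxi : @mutually_independent R dP Omega P (nat * 'I_n)%type
  (fun k => dO k.2) (fun k => Om k.2) xik.

Let path (w : Omega) := fun t i => xi t i w.
(* Omega with the sigma-algebra generated by all samples except xi_t^i. *)
Let past t i := @sigma_off _ Omega (nat * 'I_n)%type (fun k => dO k.2) (fun k => Om k.2) xik (t, i).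

Local Notation X := (fedavg tau G gb x0).
Local Notation eps := (noise tau G h gb x0).
Local Notation c := (center tau G gb x0).
Local Notation b := (drift tau G h gb x0).

Let mG i x : vmeas (G i x). Proof. by move=> j; exact: intgr_measurable (iG i x j). Qed.

Lemma lip_mean i : lipv L (h i).
Proof. exact: (@lipv_mean _ _ _ _ (D i) (G i) (h i) L (@iG i) (@EG i) (@lipG i)). Qed.

Let mpast t i r j : (r, j) != (t, i) ->
  measurable_fun setT (xi r j : past t i -> Om j).
Proof. by move=> ne; exact: (@measurable_off _ _ _ _ _ xik (t, i) (r, j)). Qed.

Let indep_past t i A B : @measurable _ (past t i) A -> measurable B ->
  (P (id @^-1` A `&` xi t i @^-1` B) = P (id @^-1` A) * D i B)%E.
Proof.
move=> mA mB; rewrite -(lawxi t mB).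
have mxik k : measurable_fun setT (xik k) by exact: mxi.
exact: (@independent_off _ _ _ _ _ _ _ _ mxik indxi (t, i) A B mA mB).
Qed.

Let mid t i : measurable_fun setT (id : Omega -> past t i).
Proof. by apply: sigma_off_sub => k; exact: mxi. Qed.

(** The iterates at time [t] use samples of rounds [r < t] only, none of which is the omitted
    one. *)
Let vX_past t i j : vmeas (fun z : past t i => X (path z) t j).
Proof.
have mpre r k : (r < t)%N -> measurable_fun setT (xi r k : past t i -> Om k).
  by move=> rt; apply: mpast; rewrite xpair_eqE (ltn_eqF rt).
exact: (@vmeas_fedavg R d n dO Om tau G L gb x0 L_gt0 mG lipG _ (past t i) xi t mpre j).
Qed.

(** The noise with the current sample as a separate argument, the form in which the past can be
    frozen. *)
Let pair_noise t i (zs : past t i * Om i) :=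
  G i (X (path zs.1) t i) zs.2 - h i (X (path zs.1) t i).

Let vpair_noise t i : vmeas (@pair_noise t i).
Proof.
have mX : vmeas (fun zs : past t i * Om i => X (path zs.1) t i).
  by move=> j; exact: (measurableT_comp (@vX_past t i i j) measurable_fst).
apply: vmeasB; last by apply: (vmeas_lip L_gt0); [exact: lip_mean|exact: mX].
by apply: (vmeas_lip2 L_gt0).
Qed.

Lemma noise_meas t i : vmeas (fun w => eps (path w) t i).
Proof.
by apply: (@vmeas_noise R d n dO Om tau G h L gb x0 L_gt0 mG lipG lip_mean _ Omega xi t i).
Qed.

(** With the past frozen, the variance assumption applies at a fixed point. The extended integral is
    used because integrability of the squared noise is deduced from this bound. *)
Lemma noise_sq_integral t i :
  (\int[P]_w (sqnorm (eps (path w) t i))%:E <= (sigma ^+ 2)%:E)%E.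
Proof.
have := @freeze_ge0 _ _ _ _ _ (past t i) _ P (D i) id (xi t i) (@mid t i) (@mxi t i)
  (@indep_past t i) (fun zs => (sqnorm (pair_noise zs))%:E).
move=> ->; last first.
- by move=> zs; rewrite lee_fin sqnorm_ge0.
- by apply/measurable_EFinP; apply: vmeas_dotv; exact: vpair_noise.
apply: (@le_trans _ _ (\int[P]_w (cst (sigma ^+ 2)%:E w))%E).
  apply: ge0_le_integral_nomeas => w.
    by apply: integral_ge0 => s _; rewrite lee_fin sqnorm_ge0.
  by rewrite /pair_noise; exact: (varG i (X (path w) t i)).
rewrite integral_cst//; set p := (X in (_ * X <= _)%E).
by have -> : p = 1%E by [exact: probability_setT]; rewrite mule1.
Qed.

Lemma noise_L2 t i : vL2 P (fun w => eps (path w) t i).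
Proof.
apply: (vL2_le (Y := fun w => sqnorm (eps (path w) t i))) => //; first exact: noise_meas.
apply/integrableP; split.
  by apply/measurable_EFinP; apply: vmeas_dotv; exact: noise_meas.
under eq_integral do rewrite /= ger0_norm ?sqnorm_ge0//.
by apply: le_lt_trans (noise_sq_integral t i) _; rewrite ltry.
Qed.

Lemma noise_sq t i : expect P (fun w => sqnorm (eps (path w) t i)) <= sigma ^+ 2.
Proof.
rewrite -lee_fin -E_integral; first exact: noise_sq_integral.
exact/vL2_sqnorm/noise_L2.
Qed.

(** Freezing all samples but [xi t i] makes [phi] and the iterate constant, and the gradient at a
    fixed point has mean [h i]. *)
Lemma noise_orth t i (phi : Omega -> 'rV[R]_d) :
  vmeas (phi : past t i -> 'rV[R]_d) -> vL2 P phi ->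
  expect P (fun w => dotv (phi w) (eps (path w) t i)) = 0.
Proof.
move=> mphi phi2; apply: EFin_inj; rewrite -E_integral; last first.
  by apply: vL2_dotv => //; exact: noise_L2.
apply: (@freeze_eq0 _ _ _ _ _ (past t i) _ P (D i) id (xi t i) (@mid t i) (@mxi t i)
  (@indep_past t i) (fun zs => dotv (phi zs.1) (pair_noise zs))).
- apply: vmeas_dotv; last exact: vpair_noise.
  by move=> j; exact: (measurableT_comp (mphi j) measurable_fst).
- by apply: vL2_dotv => //; exact: noise_L2.
- move=> z; set u := phi z; set x := X (path z) t i.
  have -> : (fun s => (dotv u (pair_noise (z, s)))%:E) =
      (fun s => (dotv u (G i x s) - dotv u (h i x))%:E).
    by apply/funext => s; rewrite -dotvBr.
  rewrite E_integral; last by apply: intgrB; [exact: intgr_dotv_cst|exact: intgr_cst].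
  rewrite EB; [|exact: intgr_dotv_cst|exact: intgr_cst].
  by rewrite E_cst (@E_dotv_cst _ _ _ _ _ _ (h i))// subrr.
Qed.

Lemma vL2_lip i (U : Omega -> 'rV[R]_d) : vL2 P U -> vL2 P (fun w => h i (U w)).
Proof.
move=> U2; apply: (vL2_le (Y := fun w => 2 * L ^+ 2 * sqnorm (U w) + 2 * sqnorm (h i 0))).
- by apply: (vmeas_lip L_gt0); [exact: lip_mean|exact: vL2_meas U2].
- by move=> w; apply: lipv_sqnorm_le => //; exact: lip_mean.
- by apply: intgrD; [apply: intgrZ; exact: vL2_sqnorm|exact: intgr_cst].
Qed.

(** Induction: each stochastic gradient is [h] at the iterate, controlled by linear growth, plus
    noise of finite variance. *)
Lemma fedavg_L2 t i : vL2 P (fun w => X (path w) t i).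
Proof.
elim: t i => [|t IH] i; first exact: vL2_cst.
have step k : vL2 P (fun w => X (path w) t k - gb *: G k (X (path w) t k) (xi t k w)).
  apply: vL2B => //; apply: vL2Z.
  have -> : (fun w => G k (X (path w) t k) (xi t k w)) =
      (fun w => h k (X (path w) t k) + eps (path w) t k).
    by apply/funext => w; rewrite /noise [h _ _ + _]addrC subrK.
  by apply: vL2D; [exact: vL2_lip|exact: noise_L2].
rewrite /fedavg /= /fed_step; case: (tau %| t.+1)%N; last exact: step.
exact: (vL2_avg step).
Qed.

Lemma center_L2 t : vL2 P (fun w => c (path w) t).
Proof. by apply: vL2_avg => i; exact: fedavg_L2. Qed.

Lemma drift_L2 t : vL2 P (fun w => b (path w) t).
Proof. by apply: vL2_avg => i; apply: vL2_lip; exact: fedavg_L2. Qed.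

Lemma hbar_L2 t : vL2 P (fun w => hbar h (c (path w) t)).
Proof. by apply: vL2_avg => i; apply: vL2_lip; exact: center_L2. Qed.

Lemma avg_noise_L2 t : vL2 P (fun w => avg_iter (eps (path w) t)).
Proof. by apply: vL2_avg => i; exact: noise_L2. Qed.

Let center_past t i : vmeas (fun z : past t i => c (path z) t).
Proof. by apply: vmeas_avg => j; exact: vX_past. Qed.

Let lip_past t i k (U : past t i -> 'rV[R]_d) : vmeas U -> vmeas (fun z => h k (U z)).
Proof. by move=> mU; apply: (vmeas_lip L_gt0) => //; exact: lip_mean. Qed.

Let drift_past t i : vmeas (fun z : past t i => b (path z) t).
Proof. by apply: vmeas_avg => j; apply: lip_past; exact: vX_past. Qed.

Lemma aux_L2 t i : vL2 P (fun w => local_step_dev tau G h gb x0 (path w) t i).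
Proof.
apply: vL2B; first by apply: vL2B; [exact: fedavg_L2|exact: center_L2].
by apply: vL2Z; apply: vL2B; [apply: vL2_lip; exact: fedavg_L2|exact: drift_L2].
Qed.

Lemma aux_orth t i :
  expect P (fun w => dotv (local_step_dev tau G h gb x0 (path w) t i) (eps (path w) t i)) = 0.
Proof.
apply: noise_orth; last exact: aux_L2.
apply: vmeasB; first by apply: vmeasB; [exact: vX_past|exact: center_past].
by apply: vmeasZ; apply: vmeasB; [apply: lip_past; exact: vX_past|exact: drift_past].
Qed.

Lemma test_L2 t : vL2 P (fun w => descent_test tau G h L gb x0 (path w) t).
Proof. by apply: vL2B; apply: vL2Z; [exact: drift_L2|exact: hbar_L2]. Qed.

Lemma test_orth t :
  expect P (fun w => dotv (descent_test tau G h L gb x0 (path w) t) (avg_iter (eps (path w) t))) = 0.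
Proof.
have i2 i : intgr P (fun w => dotv (descent_test tau G h L gb x0 (path w) t) (eps (path w) t i)).
  by apply: vL2_dotv; [exact: test_L2|exact: noise_L2].
under eq_E do rewrite dotvZr dotv_sumr.
rewrite EZ; last exact: intgr_sum.
rewrite E_sum// big1 ?mulr0// => i _; apply: noise_orth; last exact: test_L2.
apply: vmeasB; apply: vmeasZ; first exact: drift_past.
by apply: vmeas_avg => k; apply: lip_past; exact: center_past.
Qed.

(** Noises of distinct clients in the same round are orthogonal, so only [n] of the [n ^ 2] products
    survive. *)
Lemma avg_noise_sq t :
  expect P (fun w => sqnorm (avg_iter (eps (path w) t))) <= sigma ^+ 2 / n%:R.
Proof.
have i2 i j : intgr P (fun w => dotv (eps (path w) t i) (eps (path w) t j)).
  by apply: vL2_dotv; exact: noise_L2.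
under eq_E do rewrite sqnorm_avgE.
rewrite EZ; last by apply: intgr_sum => i; exact: intgr_sum.
rewrite E_sum; last by move=> i; exact: intgr_sum.
have nR : (0 : R) < n%:R by rewrite ltr0n.
have -> : sigma ^+ 2 / n%:R = n%:R ^- 2 * \sum_(i < n) sigma ^+ 2.
  rewrite sumr_const card_ord -[in RHS]mulr_natl; field; exact: lt0r_neq0.
rewrite ler_wpM2l ?invr_ge0 ?exprn_ge0 ?(ltW nR)//; apply: ler_sum => i _.
rewrite E_sum// (bigD1 i)//= big1 ?addr0; first exact: noise_sq.
move=> j ji; apply: noise_orth; last exact: noise_L2.
apply: (@vmeas_noise R d n dO Om tau G h L gb x0 L_gt0 mG lipG lip_mean _ (past t j) xi t i).
  by move=> r k rt; apply: mpast; rewrite xpair_eqE (ltn_eqF rt).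
by apply: mpast; rewrite xpair_eqE eqxx eq_sym.
Qed.

(** * Recursions in expectation and their summation *)

Variables (zeta fs : R) (f : 'rV[R]_d -> R).
Hypotheses (tau_gt0 : (0 < tau)%N) (gb_gt0 : 0 < gb).
Hypothesis gb_lt : gb < (25 * L * tau%:R)^-1.
Hypothesis zetaP : forall x, n%:R^-1 * \sum_(i < n) sqnorm (h i x - hbar h x) <= zeta ^+ 2.
Hypothesis f_cont : continuous f.
Hypothesis descf : forall x y, f y <= f x + dotv (hbar h x) (y - x) + L / 2 * sqnorm (y - x).
Hypothesis fs_le : forall x, fs <= f x.

Local Notation V := (spread tau G gb x0).

Lemma intgr_spread t : intgr P (fun w => V (path w) t).
Proof.
apply: intgrZ; apply: intgr_sum => i; apply: vL2_sqnorm.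
by apply: vL2B; [exact: fedavg_L2|exact: center_L2].
Qed.

(** [f] lies between the constant [fs] and the quadratic upper bound of [descf] around 0, and the
    center is square integrable. *)
Lemma intgr_value t : intgr P (fun w => f (c (path w) t)).
Proof.
apply: (intgr_le (Y := fun w =>
  (1 + L / 2) * sqnorm (c (path w) t) + (`|fs| + `|f 0| + sqnorm (hbar h 0)))).
- apply: (@measurable_caratheodory _ _ _ _ _ _ (fun x (_ : Omega) => f x)
    (fun w => c (path w) t) id) => //.
  by move=> j; have [] := center_L2 t j.
- move=> w; set x := c _ _; have := descf 0 x; rewrite subr0.
  have := sqnorm_ge0 (hbar h 0 - x); rewrite sqnormB.
  have := sqnorm_ge0 (hbar h 0); have := sqnorm_ge0 x; have := fs_le x.
  have Ls : 0 <= L / 2 * sqnorm x by rewrite mulr_ge0 ?sqnorm_ge0// divr_ge0// ltW.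
  move: (dotv (hbar h 0) x) (sqnorm (hbar h 0)) (f x) => p q fx.
  move: (sqnorm x) Ls => s Ls.
  have := ler_norm (f 0); have := ler_norm (- fs); rewrite normrN.
  have := normr_ge0 fs; have := normr_ge0 (f 0).
  rewrite (mulrDl 1 (L / 2) s) mul1r; move: (L / 2 * s) Ls => v v0.
  by move=> *; rewrite ler_norml; apply/andP; split; lra.
- by apply: intgrD; [apply: intgrZ; apply: vL2_sqnorm; exact: center_L2|exact: intgr_cst].
Qed.

Lemma E_descent_step t :
  expect P (fun w => f (c (path w) t.+1)) <=
  expect P (fun w => f (c (path w) t)) - gb / 2 * expect P (fun w => sqnorm (hbar h (c (path w) t)))
  + gb / 2 * L ^+ 2 * expect P (fun w => V (path w) t) + L / 2 * gb ^+ 2 * (sigma ^+ 2 / n%:R).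
Proof.
have i1 := intgr_value t; have i2 := vL2_sqnorm (hbar_L2 t).
have i3 := intgr_spread t; have i4 := vL2_sqnorm (avg_noise_L2 t).
have i5 := vL2_dotv (test_L2 t) (avg_noise_L2 t).
have j2 := intgrZ (gb / 2) i2; have j3 := intgrZ (gb / 2 * L ^+ 2) i3.
have j4 := intgrZ (L / 2 * gb ^+ 2) i4.
have k1 := intgrB i1 j2; have k2 := intgrD k1 j3; have k3 := intgrD k2 i5.
apply: (le_trans (le_E (intgr_value t.+1) (intgrD k3 j4) _)).
  by move=> w; exact: (descent_step G x0 n_gt0 tau_gt0 L_gt0 gb_gt0 gb_lt lip_mean descf).
rewrite (ED k3 j4) (ED k2 i5) (ED k1 j3) (EB i1 j2) (EZ _ i2) (EZ _ i3) (EZ _ i4) test_orth addr0 lerD2l.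
by rewrite ler_wpM2l ?avg_noise_sq// mulr_ge0 ?sqr_ge0// divr_ge0// ltW.
Qed.

(** What one local step adds to the mean spread, besides the growth factor [1 + 2 / tau]. *)
Let beta := gb ^+ 2 * (sigma ^+ 2 + 4 * tau%:R * zeta ^+ 2).

Lemma E_spread_step t : ~~ (tau %| t.+1)%N ->
  expect P (fun w => V (path w) t.+1) <= (1 + 2 / tau%:R) * expect P (fun w => V (path w) t) + beta.
Proof.
move=> td.
have i1 i : intgr P (fun w => sqnorm (eps (path w) t i)) by exact/vL2_sqnorm/noise_L2.
have i2 i : intgr P (fun w => dotv (local_step_dev tau G h gb x0 (path w) t i) (eps (path w) t i)).
  by apply: vL2_dotv; [exact: aux_L2|exact: noise_L2].
have j1 i := intgrZ (gb ^+ 2) (i1 i); have j2 i := intgrZ (2 * gb) (i2 i).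
have k i := intgrB (j1 i) (j2 i); have ks := intgr_sum k.
have ks' := intgrZ n%:R^-1 ks; have l1 := intgrZ (1 + 2 / tau%:R) (intgr_spread t).
have l2 := intgr_cst P (4 * tau%:R * gb ^+ 2 * zeta ^+ 2).
apply: (le_trans (le_E (intgr_spread t.+1) (intgrD (intgrD l1 l2) ks') _)).
  by move=> w; exact: (spread_step G x0 n_gt0 tau_gt0 L_gt0 gb_gt0 gb_lt lip_mean zetaP (path w) td).
rewrite (ED (intgrD l1 l2) ks') (ED l1 l2) (EZ _ (intgr_spread t)) (EZ _ ks) (E_sum k).
rewrite -addrA lerD2l E_cst /beta mulrDr addrC.
have -> : gb ^+ 2 * (4 * tau%:R * zeta ^+ 2) = 4 * tau%:R * gb ^+ 2 * zeta ^+ 2 by ring.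
rewrite lerD2r ler_pdivrMl ?ltr0n// [leRHS]mulr_natl.
have -> : (gb ^+ 2 * sigma ^+ 2) *+ n = \sum_(i < n) gb ^+ 2 * sigma ^+ 2.
  by rewrite sumr_const card_ord.
apply: ler_sum => i _; rewrite (EB (j1 i) (j2 i)) (EZ _ (i1 i)) (EZ _ (i2 i)) aux_orth mulr0 subr0.
by rewrite ler_wpM2l ?sqr_ge0// noise_sq.
Qed.

Let beta_ge0 : 0 <= beta.
Proof.
apply: mulr_ge0; first exact: sqr_ge0.
apply: addr_ge0; first exact: sqr_ge0.
by apply: mulr_ge0; [exact: mulr_ge0|exact: sqr_ge0].
Qed.

(** [t %% tau] counts the local steps since the last synchronization, where the spread was zero.
    Every one of the accumulated [beta] terms is charged the full power of the growth factor. *)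
Lemma E_spread_le t :
  expect P (fun w => V (path w) t) <= beta * (t %% tau)%:R * (1 + 2 / tau%:R) ^+ (t %% tau).
Proof.
have V0 r : (tau %| r)%N -> expect P (fun w => V (path w) r) = 0.
  move=> rd; rewrite -[RHS](E_cst P 0); apply: eq_E => w.
  exact: spread_sync.
have q1 : 1 <= 1 + 2 / tau%:R :> R by rewrite lerDl divr_ge0.
elim: t => [|t IH]; first by rewrite V0// mod0n mulr0 mul0r.
rewrite modnS; case: ifPn => td; first by rewrite V0// mulr0 mul0r.
apply: le_trans (E_spread_step td) _; move: (t %% tau)%N IH => r IH.
have q0 : 0 <= 1 + 2 / tau%:R :> R by exact: le_trans q1.
apply: (@le_trans _ _ ((1 + 2 / tau%:R) * (beta * r%:R * (1 + 2 / tau%:R) ^+ r) + beta)).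
  by rewrite lerD2r ler_wpM2l.
set q := 1 + _ in q0 q1 *.
have -> : beta * r.+1%:R * q ^+ r.+1 = q * (beta * r%:R * q ^+ r) + beta * q ^+ r.+1.
  by rewrite -natr1 exprS; ring.
by rewrite lerD2l ler_peMr// exprn_ege1.
Qed.

Lemma E_spread_bound t :
  expect P (fun w => V (path w) t) <= expR 2 * (tau%:R * beta).
Proof.
apply: le_trans (E_spread_le t) _.
have q1 : 1 <= 1 + 2 / tau%:R :> R by rewrite lerDl divr_ge0.
have rt : (t %% tau <= tau)%N by rewrite ltnW// ltn_mod.
have tR : (tau%:R : R) != 0 by rewrite pnatr_eq0 -lt0n.
(* At most [tau] growth factors occur, each bounded by [1 + x <= expR x]. *)
have qe : (1 + 2 / tau%:R) ^+ (t %% tau) <= expR 2 :> R.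
  apply: (@le_trans _ _ ((1 + 2 / tau%:R) ^+ tau)); first exact: ler_weXn2l.
  have -> : expR 2 = expR (2 / tau%:R) ^+ tau :> R.
    by rewrite -expRM_natl mulrC divfK.
  by rewrite lerXn2r ?nnegrE ?expR_ge0 ?expR_ge1Dx// (le_trans _ q1).
rewrite [leRHS]mulrC [tau%:R * _]mulrC.
apply: ler_pM => //; first by rewrite mulr_ge0.
by rewrite ler_wpM2l// ler_nat.
Qed.

(** By contradiction: if every mean squared gradient before [T] exceeded the bound, the summed
    descent would push the expected value below [fs]. *)
Theorem fedavg_bound T : (0 < T)%N -> exists t, (t < T)%N /\
  (\int[P]_w (sqnorm (hbar h (c (path w) t)))%:E <=
   (4 * expR 2 * ((f x0 - fs) / (gb * T%:R) + gb * L * sigma ^+ 2 / n%:R +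
      gb ^+ 2 * L ^+ 2 * tau%:R * (sigma ^+ 2 + tau%:R * zeta ^+ 2)))%:E)%E.
Proof.
move=> T0; set bnd := 4 * _ * _.
pose g t := expect P (fun w => sqnorm (hbar h (c (path w) t))).
suff [t [tT gt]] : exists t, (t < T)%N /\ g t <= bnd.
  by exists t; split=> //; rewrite E_integral ?lee_fin//; exact/vL2_sqnorm/hbar_L2.
apply: contrapT => nex.
have gt t : (t < T)%N -> bnd < g t.
  by move=> tT; rewrite ltNge; apply/negP => gb'; apply: nex; exists t.
pose a t := expect P (fun w => f (c (path w) t)).
pose K := gb / 2 * L ^+ 2 * (expR 2 * (tau%:R * beta)) + L / 2 * gb ^+ 2 * (sigma ^+ 2 / n%:R).
have step t : a t.+1 <= a t - gb / 2 * g t + K.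
  apply: le_trans (E_descent_step t) _; rewrite -/(a t) -/(g t) /K !addrA !lerD2r lerD2l.
  apply: ler_wpM2l; last exact: E_spread_bound.
  by apply: mulr_ge0; [rewrite divr_ge0// ltW|exact: sqr_ge0].
have a0 : a 0%N = f x0.
  rewrite -[RHS](E_cst P); apply: eq_E => w; rewrite /center /fedavg/=.
  by rewrite avg_iter_cst.
have afs : forall r, fs <= a r.
  move=> r.
  by rewrite -[leLHS](E_cst P); apply: le_E => //; [exact: intgr_cst|exact: intgr_value].
(* The inequality is strict only once a step has been taken, hence [0 < r]; at [r = 0] equality [a0]
   is used. *)
have sum : forall r, (0 < r)%N -> (r <= T)%N -> a r < f x0 + r%:R * (K - gb / 2 * bnd).
  elim => // r IH _ tT.
  have lt_g : gb / 2 * bnd < gb / 2 * g r by rewrite ltr_pM2l ?gt// divr_gt0.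
  have le_next : a r.+1 <= a r + (K - gb / 2 * g r).
    by apply: le_trans (step r) _; rewrite addrAC -addrA.
  have lt_next : a r.+1 < a r + (K - gb / 2 * bnd).
    by apply: le_lt_trans le_next _; rewrite ltrD2l ltrD2l ltrN2.
  apply: lt_le_trans lt_next _; rewrite -(natr1 r) (mulrDl r%:R 1) mul1r (addrA (f x0)) lerD2r.
  case: r IH tT {lt_g le_next} => [|r] IH tT; first by rewrite mul0r addr0 a0.
  exact: ltW (IH isT (ltnW tT)).
have := le_lt_trans (afs T) (sum T T0 (leqnn T)); apply/negP; rewrite -leNgt.
have TR : (0 : R) < T%:R by rewrite ltr0n.
have nR : (0 : R) < n%:R by rewrite ltr0n.
have e1 : 1 <= expR 2 :> R by apply: le_trans (expR_ge1Dx 2); lra.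
have fs0 : 0 <= f x0 - fs by rewrite subr_ge0.
have tR : (0 : R) < tau%:R by rewrite ltr0n.
(* After scaling by [2 / gb] the three terms carry the factors 2, 1 and [expR 2], the last with
   [4 * tau * zeta ^+ 2] inside; [4 * expR 2] dominates all of them. *)
suff H : 2 / gb * (f x0 - fs + T%:R * K) <= T%:R * bnd.
  have : gb / 2 * (2 / gb * (f x0 - fs + T%:R * K)) <= gb / 2 * (T%:R * bnd).
    by rewrite ler_wpM2l// divr_ge0// ltW.
  have -> : gb / 2 * (2 / gb * (f x0 - fs + T%:R * K)) = f x0 - fs + T%:R * K.
    by field; rewrite gt_eqF.
  by rewrite mulrBr [T%:R * (gb / 2 * _)]mulrCA; lra.
have -> : 2 / gb * (f x0 - fs + T%:R * K) = T%:R * (2 * ((f x0 - fs) / (gb * T%:R)) +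
    gb * L * sigma ^+ 2 / n%:R + expR 2 * (gb ^+ 2 * L ^+ 2 * tau%:R * (sigma ^+ 2 + 4 * tau%:R * zeta ^+ 2))).
  by rewrite /K /beta; field; rewrite !gt_eqF.
rewrite ler_pM2l// /bnd.
have t1 : 0 <= (f x0 - fs) / (gb * T%:R) by rewrite divr_ge0// mulr_ge0// ltW.
have t2 : 0 <= gb * L * sigma ^+ 2 / n%:R.
  by rewrite divr_ge0// mulr_ge0 ?sqr_ge0// mulr_ge0// ltW.
have t3 : 0 <= gb ^+ 2 * L ^+ 2 * tau%:R.
  by apply: mulr_ge0 => //; apply: mulr_ge0; exact: sqr_ge0.
have s0 := sqr_ge0 sigma; have z0 : 0 <= tau%:R * zeta ^+ 2.
  by rewrite mulr_ge0 ?sqr_ge0.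
move: ((f x0 - fs) / _) (gb * L * sigma ^+ 2 / _) (gb ^+ 2 * L ^+ 2 * tau%:R) t1 t2 t3 => u v m t1 t2 t3.
move: (sigma ^+ 2) s0 => ss s0; rewrite -[4 * _ * zeta ^+ 2]mulrA.
move: (tau%:R * zeta ^+ 2) z0 => z z0.
rewrite (mulrDr _ (u + v)) (mulrDr _ u); apply: lerD; [apply: lerD|].
- by apply: ler_wpM2r => //; lra.
- by rewrite -[leLHS]mul1r; apply: ler_wpM2r => //; lra.
- have -> : 4 * expR 2 * (m * (ss + z)) = expR 2 * (m * (4 * (ss + z))) by ring.
  apply: ler_wpM2l; first exact: expR_ge0.
  by apply: ler_wpM2l => //; lra.
Qed.

End Expectation.

(** Raising [g] to [+oo] on a measurable null set keeps its integral and makes it dominate [f]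
    everywhere, so [f] itself may be non-measurable. *)
Lemma le_integral_ae_nomeas {R : realType} {dT} {T : measurableType dT}
  (mu : {measure set T -> \bar R}) (f g : T -> \bar R) :
  measurable_fun setT g -> (forall x, 0 <= f x)%E -> (forall x, 0 <= g x)%E ->
  {ae mu, forall x, f x = g x} -> (\int[mu]_x f x <= \int[mu]_x g x)%E.
Proof.
move=> mg f0 g0 [N [mN N0 subN]].
pose u : T -> \bar R := (cst +oo%E) \_ N.
pose k x := (g x + u x)%E.
have k0 x : (0 <= u x)%E by rewrite /u patchE; case: ifP => _; [exact: leey|exact: lexx].
have mk : measurable_fun setT u.
  by apply/(measurable_restrictT _ mN); exact: measurable_cst.
have -> : (\int[mu]_x g x = \int[mu]_x k x)%E.
  apply: ge0_ae_eq_integral => //.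
  - exact: emeasurable_funD.
  - by move=> x _; exact: adde_ge0.
  - exists N; split=> // x /= H; apply: contrapT => nN; apply: H => _.
    by rewrite /k /u patchE memNset// adde0.
apply: ge0_le_integral_nomeas => // x; rewrite /k /u patchE.
have [xN|xN] := boolP (x \in N).
  by rewrite addey ?leey// -ltNye (lt_le_trans _ (g0 x)).
rewrite adde0; suff -> : f x = g x by [].
by apply: contrapT => fg; move/negP: xN; apply; rewrite inE; exact: subN.
Qed.

(** * Cutting gradients off outside a set of full measure *)

Section FullMeasure.
Context {R : realType} {d : nat} {dW : measure_display} {W : measurableType dW}.
Variables (Q : probability W R) (S : set W).
Hypotheses (mS : measurable S) (QS : Q S = 1%E).

Lemma full_ae : {ae Q, forall s, S s}.
Proof.
exists (~` S); split=> //; first exact: measurableC.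
by rewrite probability_setC// QS subee.
Qed.

(* Off S the gradient of F i is not even Lipschitz in x; cutting it off there makes
   the Lipschitz bound hold for every sample. *)
Definition cut_off (g : W -> 'rV[R]_d) s := if s \in S then g s else 0.

Lemma cut_ae (g : W -> 'rV[R]_d) : {ae Q, forall s, cut_off g s = g s}.
Proof. by apply: filterS full_ae => s Ss; rewrite /cut_off mem_set. Qed.

Lemma cut_coord (g : W -> 'rV[R]_d) j : (fun s => cut_off g s 0 j) = (fun s => g s 0 j) \_ S.
Proof. by apply/funext => s; rewrite /cut_off patchE; case: ifP => //; rewrite mxE. Qed.

Lemma intgr_cut (g : W -> 'rV[R]_d) j : intgr Q (fun s => g s 0 j) -> intgr Q (fun s => cut_off g s 0 j).
Proof.
move=> ig; apply: (@le_integrable _ _ _ _ _ measurableT _ (EFin \o (fun s => g s 0 j))) => //.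
  apply/measurable_EFinP; rewrite cut_coord; apply/(measurable_restrictT _ mS).
  exact: measurable_funTS (intgr_measurable ig).
by move=> s _; rewrite /cut_off /= lee_fin; case: ifP => //; rewrite mxE normr0.
Qed.

Lemma E_cut (g : W -> 'rV[R]_d) j : intgr Q (fun s => g s 0 j) ->
  expect Q (fun s => cut_off g s 0 j) = expect Q (fun s => g s 0 j).
Proof.
move=> ig; congr fine; apply: ae_eq_integral => //.
- by case/integrableP: (intgr_cut ig).
- by case/integrableP: ig.
- by apply: filterS (cut_ae g) => s /= -> _.
Qed.

Lemma var_cut (g : W -> 'rV[R]_d) (m : 'rV[R]_d) : (forall j, intgr Q (fun s => g s 0 j)) ->
  (\int[Q]_s (sqnorm (cut_off g s - m))%:E = \int[Q]_s (sqnorm (g s - m))%:E)%E.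
Proof.
move=> ig; have mm : vmeas (fun _ : W => m) by move=> j; exact: measurable_cst.
have msq k : vmeas k -> measurable_fun setT (fun s => (sqnorm (k s - m))%:E).
  by move=> mk; apply/measurable_EFinP; apply: vmeas_dotv; exact: vmeasB.
apply: ae_eq_integral => //.
- by apply: msq => j; exact: intgr_measurable (intgr_cut (ig j)).
- by apply: msq => j; exact: intgr_measurable (ig j).
- by apply: filterS (cut_ae g) => s /= -> _.
Qed.

Lemma lipv_cut (g : 'rV[R]_d -> W -> 'rV[R]_d) L s : 0 <= L ->
  (S s -> lipv L (g^~ s)) -> lipv L (fun x => cut_off (g x) s).
Proof.
move=> L0 lg x y; rewrite /cut_off; case: ifPn => [sS|_].
  by rewrite inE in sS; exact: (lg sS x y).
by rewrite subrr {1}/enorm sqnorm0 sqrtr0; apply: mulr_ge0 => //; exact: enorm_ge0.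
Qed.

End FullMeasure.

(** * Reduction of FedSPS to FedAvg with constant step *)

Lemma lipv_avg {R : realType} {d n : nat} (L : R) (h : 'I_n -> 'rV[R]_d -> 'rV[R]_d) :
  (0 < n)%N -> 0 <= L -> (forall i, lipv L (h i)) -> lipv L (hbar h).
Proof.
move=> n0 L0 lh x y; rewrite -[leRHS]ger0_norm ?mulr_ge0 ?enorm_ge0// -sqrtr_sqr.
rewrite ler_wsqrtr// exprMn sqr_enorm /hbar -avg_iterB.
apply: le_trans (sqnorm_avg_le n0 _) _; rewrite ler_pdivrMl ?ltr0n// mulr_natl.
rewrite -[leRHS](_ : \sum_(i < n) L ^+ 2 * sqnorm (y - x) = _); last by rewrite sumr_const card_ord.
by apply: ler_sum => i _; apply: le_enorm_sqnorm => //; exact: lh.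
Qed.

(** A zero gradient gives [gb] by convention. Otherwise [sqnorm_gradient_le] bounds the Polyak
    quotient below by [1 / (2 * c * L)]. *)
Lemma sps_step_eq {R : realType} {d : nat} (c gb l L : R) (f : 'rV[R]_d -> R) x :
  (forall z, differentiable f z) -> 0 < L -> 0 < c -> 0 < gb ->
  gb < (2 * c * L)^-1 -> lipv L (gradient f) -> (forall z, l <= f z) ->
  sps_step c gb l (f x) (gradient f x) = gb.
Proof.
move=> df L0 c0 gb0 gbL lip lf; rewrite /sps_step; case: ifPn => // q0.
have qp : 0 < sqnorm (gradient f x) by rewrite lt_neqAle eq_sym q0 sqnorm_ge0.
apply/min_idPr; rewrite ler_pdivlMr ?mulr_gt0//.
have H := sqnorm_gradient_le x df L0 lip lf.
have lx : 0 <= f x - l by rewrite subr_ge0.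
have K : gb * (2 * c * L) <= 1 by rewrite -ler_pdivlMr ?mulr_gt0// mul1r ltW.
apply: (@le_trans _ _ (gb * (c * (2 * L * (f x - l))))).
  by rewrite ler_pM2l// ler_pM2l.
have -> : gb * (c * (2 * L * (f x - l))) = gb * (2 * c * L) * (f x - l) by ring.
by rewrite -[leRHS]mul1r ler_wpM2r.
Qed.

(** Agreement is asked only at the samples of the path [s], so two schemes that agree on the support
    have the same iterates almost surely. *)
Lemma fed_iter_eq {R : realType} {d n : nat} {Om : 'I_n -> Type} (tau : nat)
  (gam1 gam2 : forall i, 'rV[R]_d -> Om i -> R)
  (grd1 grd2 : forall i, 'rV[R]_d -> Om i -> 'rV[R]_d) x0 (s : nat -> forall i, Om i) :
  (forall t i x, gam1 i x (s t i) = gam2 i x (s t i) /\ grd1 i x (s t i) = grd2 i x (s t i)) ->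
  forall t, fed_iter tau gam1 grd1 x0 s t = fed_iter tau gam2 grd2 x0 s t.
Proof.
move=> H; elim=> //= t ->; rewrite /fed_step; congr (if _ then _ else _).
  by apply/funext => _; congr (_ *: _); apply: eq_bigr => i _; have [-> ->] := H t i (fed_iter tau gam2 grd2 x0 s t i).
by apply/funext => i; have [-> ->] := H t i (fed_iter tau gam2 grd2 x0 s t i).
Qed.

Unset Implicit Arguments.

(** * Assembly for both step rules *)

Theorem theorem4 (R : realType) :
  exists C : R, 0 < C /\
  forall (n d tau : nat) (dO : 'I_n -> measure_display)
    (Om : forall i, measurableType (dO i))
    (D : forall i, probability (Om i) R)
    (S : forall i, set (Om i))  (* supp(D_i) *)
    (F : forall i, 'rV[R]_d -> Om i -> R)
    (ell : 'I_n -> R) (L sigma zeta c gb : R) (x0 : 'rV[R]_d) (T : nat)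
    (dP : measure_display) (Omega : measurableType dP)
    (P : probability Omega R)
    (xi : nat -> forall i, Omega -> Om i),
  let gradF i x xi := gradient (fun y => F i y xi) x in
  let f_ i x := Rintegral (D i) setT (fun xi => F i x xi) in
  let f x := n%:R^-1 * \sum_(i < n) f_ i x in
  let fstar := inf (range f) in
  (0 < n)%N -> (0 < d)%N -> (0 < tau)%N ->
  (* the support: a measurable set of full measure *)
  (forall i, measurable (S i) /\ D i (S i) = 1%E) ->
  (* F_i(., xi) differentiable for xi in supp(D_i) *)
  (forall i xi, S i xi -> forall x, differentiable (fun y => F i y xi) x) ->
  (* F_i^* finite and ell_i^* <= F_i^* *)
  (forall i, has_lbound [set F i x xi | x in setT & xi in S i] /\
             ell i <= inf [set F i x xi | x in setT & xi in S i]) ->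
  (* f_i(x) = E F_i(x, xi) is well defined *)
  (forall i x, (D i).-integrable setT (fun xi => (F i x xi)%:E)) ->
  (* unbiasedness:  E grad F_i(x, xi) = grad f_i(x) *)
  (forall i x, differentiable (f_ i) x /\
     forall j, (D i).-integrable setT (fun xi => (gradF i x xi 0 j)%:E) /\
               Rintegral (D i) setT (fun xi => gradF i x xi 0 j)
               = gradient (f_ i) x 0 j) ->
  (* L-smoothness *)
  0 < L ->
  (forall i xi, S i xi -> forall x y,
       enorm (gradF i y xi - gradF i x xi) <= L * enorm (x - y)) ->
  (* bounded variance *)
  0 <= sigma -> 0 <= zeta ->
  (forall i x, (\int[D i]_xi (sqnorm (gradF i x xi - gradient (f_ i) x))%:E
                <= (sigma ^+ 2)%:E)%E) ->
  (forall x, n%:R^-1 * \sum_(i < n) sqnorm (gradient (f_ i) x - gradient f x)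
             <= zeta ^+ 2) ->
  (* f^* = inf f > -oo *)
  has_lbound (range f) ->
  (* step-size parameters *)
  0 < c -> 0 < gb ->
  gb < (2 * c * L)^-1 -> gb < (25 * L * tau%:R)^-1 ->
  (* the samples xi_t^i : independent, xi_t^i ~ D_i *)
  (forall t i, measurable_fun setT (xi t i)) ->
  (forall t i A, measurable A -> P (xi t i @^-1` A) = D i A) ->
  @mutually_independent R dP Omega P (nat * 'I_n)%type
    (fun k => dO k.2) (fun k => Om k.2) (fun k => xi k.1 k.2) ->
  (1 <= T)%N ->
  let sps i x xi := sps_step c gb (ell i) (F i x xi) (gradF i x xi) in
  let cst i (x : 'rV[R]_d) (xi : Om i) := gb in
  let bound := C * ((f x0 - fstar) / (gb * T%:R) + gb * L * sigma ^+ 2 / n%:R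
                    + gb ^+ 2 * L ^+ 2 * tau%:R * (sigma ^+ 2 + tau%:R * zeta ^+ 2)) in
  let E gam t := (\int[P]_w
        (sqnorm (gradient f (avg_iter
           (fed_iter tau gam gradF x0 (fun t i => xi t i w) t))))%:E)%E in
  (* FedSPS *)
  (\big[Order.min/+oo%E]_(t < T) E sps t <= bound%:E)%E /\
  (* FedAvg with constant step size gb *)
  (\big[Order.min/+oo%E]_(t < T) E cst t <= bound%:E)%E.
Proof.
exists (4 * expR 2); split; first by rewrite mulr_gt0 ?expR_gt0.
move=> n d tau dO Om D S F ell L sigma zeta c gb x0 T dP Omega P xi gradF f_ f fstar.
move=> n0 d0 tau0 HS dF lbF iF HE L0 lipF sigma0 zeta0 varF zetaF lbf c0 gb0 gbc gbt.
move=> mxi lawxi indxi T1 sps cst bound EE.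
pose h i := gradient (f_ i).
(* [fedavg_bound] asks for Lipschitz gradients at every sample; the cut-off provides this without
   changing means and variances. *)
pose G i x s := cut_off (S i) (gradF i x) s.
have iF' i x j : intgr (D i) (fun s => gradF i x s 0 j) by have [_ /(_ j)[]] := HE i x.
have EF' i x j : expect (D i) (fun s => gradF i x s 0 j) = h i x 0 j.
  by have [_ /(_ j)[]] := HE i x.
have mS i : measurable (S i) by case: (HS i).
have QS i : D i (S i) = 1%E by case: (HS i).
have lipFS i s : S i s -> lipv L (gradient (fun y => F i y s)).
  move=> Ss x y; apply: le_trans (lipF i s Ss x y) _.
  by rewrite /enorm sqnormBC.
have iG i x j : intgr (D i) (fun s => G i x s 0 j) by exact: intgr_cut.
have EG i x j : expect (D i) (fun s => G i x s 0 j) = h i x 0 j.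
  by rewrite -EF'; exact: E_cut.
have lipG i s : lipv L (fun x => G i x s).
  by apply: (@lipv_cut _ _ _ _ (S i) (gradF i)); [exact: ltW|exact: lipFS].
have varG i x : (\int[D i]_s (sqnorm (G i x s - h i x))%:E <= (sigma ^+ 2)%:E)%E.
  by rewrite /G var_cut.
have df_ i x : differentiable (f_ i) x by have [] := HE i x.
have fE x : differentiable f x /\ gradient f x = hbar h x.
  exact: (@gradient_mean R d n f_ n%:R^-1 x (fun i => df_ i x)).
have liph i : lipv L (h i).
  exact: (@lipv_mean _ _ _ _ (D i) (G i) (h i) L (iG i) (EG i) (lipG i)).
have liphb : lipv L (gradient f).
  have -> : gradient f = hbar h by apply/funext => x; have [] := fE x.
  by apply: lipv_avg => //; exact: ltW.
have descf x y : f y <= f x + dotv (hbar h x) (y - x) + L / 2 * sqnorm (y - x).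
  have [_ <-] := fE x; apply: descent => //; last exact: ltW.
  by move=> z; have [] := fE z.
have zetaP x : n%:R^-1 * \sum_(i < n) sqnorm (h i x - hbar h x) <= zeta ^+ 2.
  by have [_ <-] := fE x; exact: zetaF.
have fcont : continuous f by move=> x; apply: differentiable_continuous; have [] := fE x.
have fs_le x : fstar <= f x by apply: ge_inf => //; exists x.
have [t [tT Ht]] := @fedavg_bound R d n dO Om dP Omega D P xi tau G h L gb sigma x0
  n0 L0 lipG iG EG varG mxi lawxi indxi zeta fstar f tau0 gb0 gbt zetaP fcont descf fs_le T T1.
(* Countably many rounds and finitely many clients: almost surely all samples lie in the supports at
   once. *)
have ae_S : {ae P, forall w, forall r i, S i (xi r i w)}.
  apply: ae_foralln => r; apply: filter_forall => i.
  exists (xi r i @^-1` (~` S i)); split=> //.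
  - by rewrite -[X in measurable X]setTI; apply: mxi => //; exact: measurableC.
  - apply: (eq_trans (lawxi r i _ (measurableC (mS i)))).
    by rewrite probability_setC// QS subee.
have spsE i s x : S i s -> sps i x s = gb.
  move=> Ss; have lFs z : ell i <= F i z s.
    have [lb le_inf] := lbF i; apply: le_trans le_inf _.
    by apply: (ge_inf lb); exists z => //; exists s.
  exact: (@sps_step_eq _ _ c gb (ell i) L (fun y => F i y s) x
    (dF i s Ss) L0 c0 gb0 gbc (lipFS i s Ss) lFs).
(* Any step rule equal to [gb] on the supports almost surely reproduces the cut-off FedAvg run, so
   its integral at the index [t] found above obeys the same bound. *)
have key gam : (forall i x s, S i s -> gam i x s = gb) -> (EE gam t <= bound%:E)%E.
  move=> gamE; apply: le_trans Ht; apply: le_integral_ae_nomeas.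
  - apply/measurable_EFinP; apply: intgr_measurable; apply: vL2_sqnorm.
    exact: (@hbar_L2 R d n dO Om dP Omega D P xi tau G h L gb sigma x0 L0 lipG iG EG varG mxi lawxi indxi).
  - by move=> w; rewrite lee_fin sqnorm_ge0.
  - by move=> w; rewrite lee_fin sqnorm_ge0.
  - apply: filterS ae_S => w Sw.
    rewrite (proj2 (fE _)) /center /fedavg; congr ((sqnorm (hbar h (avg_iter _)))%:E).
    apply: fed_iter_eq => r i x; split; first exact: gamE.
    by rewrite /G /cut_off mem_set.
split; apply: (@le_trans _ _ _ _ _ (bigmin_le _ (Ordinal tT) _)); apply: key => //.
by move=> i x s; exact: spsE.
Qed.
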